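(* Let $L, M, N : \mathcal U$ be types, $f : L \to M$ and $g : L \to N$ functions, and let $P :\equiv M \sqcup^L N$ be their (homotopy) pushout, with $\mathsf{in} : (M+N) \to P$ the map given by $(\mathsf{inl},\mathsf{inr})$. Let $\mathfrak C : (M+N) \to (M+N) \to \mathcal U$ be the indexed higher inductive family defined in the context. Then for all $x, y : M+N$ there is an equivalence $$(\mathsf{in}(x) =_P \mathsf{in}(y)) \;\simeq\; \mathfrak C(x,y).$$
   Context: The setting is standard homotopy type theory (as in the HoTT book): $\Pi$-, $\Sigma$-types, sums, univalent universes $\mathcal U$, and (indexed, higher) inductive types. Equality (identity) types are written $x = y$; $X \simeq Y$ is the type of equivalences. Pushout: $M \sqcup^L N$ is the higher inductive type generated by $\mathsf{inl} : M \to M \sqcup^L N$, $\mathsf{inr} : N \to M \sqcup^L N$ and $\mathsf{glue} : \Pi(l : L).\ \mathsf{inl}(f(l)) = \mathsf{inr}(g(l))$. The family $\mathfrak C$: the inclusions $M \to M+N$ and $N \to M+N$ are kept implicit. For a fixed base point $x : M+N$, the family $C :\equiv \mathfrak C(x,\_) : (M+N) \to \mathcal U$ is the indexed higher inductive type with constructors - $\mathsf{nil} : C(x)$, - $\mathsf{gl} : \Pi(l : L).\ C(f(l)) \simeq C(g(l))$. The second constructor is shorthand for the following five constructors making $\mathsf{gl}(l)$ a bi-invertible map: - $\mathsf{gl} : \Pi(l : L).\ C(f(l)) \to C(g(l))$, - $\mathsf{linv} : \Pi(l : L).\ C(g(l)) \to C(f(l))$, - $\mathsf{leq} : \Pi(l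 : L),(z : C(f(l))).\ \mathsf{linv}(l,\mathsf{gl}(l,z)) = z$, - $\mathsf{rinv} : \Pi(l : L).\ C(g(l)) \to C(f(l))$, - $\mathsf{req} : \Pi(l : L),(w : C(g(l))).\ \mathsf{gl}(l,\mathsf{rinv}(l,w)) = w$. No set-truncation is imposed. *)

(* Defs.v *)
From Stdlib Require Import List.
Import ListNotations.

(** * Homotopy type theory as a formal system

    The ambient theory is represented by its syntax, in the style of the first
    presentation in the appendix of the HoTT book: lambda-terms over a family
    of typed constants, with an untyped convertibility relation generated by
    the defining equations of the constants.  A shallow rendering, with
    univalence as a hypothesis, would be vacuous: the elimination rule of any
    identity type applies to families built with Rocq's own [eq], which
    satisfies uniqueness of identity proofs under classical axioms, so the
    hypotheses would be contradictory in classical logic.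

    Only the type formers needed for the statement are included (dependent
    products and sums, binary sums, identity types, univalent universes,
    pushouts and the family [C]).  Derivations remain derivations when further
    type formers are added. *)

Inductive cst : Set :=
  (* In every constant [n] is the level of the types involved and [m] the
     level of the motive of an eliminator. *)
  | cSig (n : nat) | cPair (n : nat) | cSigInd (n m : nat)
  | cSum (n : nat) | cInl (n : nat) | cInr (n : nat) | cSumInd (n m : nat)
  | cId (n : nat) | cRefl (n : nat) | cJ (n m : nat)
  | cUnivalence (n : nat)
  | cPO (n : nat) | cPOinl (n : nat) | cPOinr (n : nat) | cPOglue (n : nat)
  | cPOind (n m : nat) | cPOindGlue (n m : nat)
  | cC (n : nat) | cNil (n : nat) | cGl (n : nat) | cLinv (n : nat)
  | cLeq (n : nat) | cRinv (n : nat) | cReq (n : nat)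
  | cCind (n m : nat) | cCindLeq (n m : nat) | cCindReq (n m : nat).

(** De Bruijn indices: [Pi] binds one variable in its second argument and
    [Lam] one in its body. *)
Inductive tm : Set :=
  | Var (i : nat)
  | Univ (n : nat)
  | Pi (A B : tm)
  | Lam (b : tm)
  | App (t u : tm)
  | Cst (c : cst).

Fixpoint lift (k : nat) (t : tm) : tm :=
  match t with
  | Var i => Var (if Nat.leb k i then S i else i)
  | Univ n => Univ n
  | Pi A B => Pi (lift k A) (lift (S k) B)
  | Lam b => Lam (lift (S k) b)
  | App t u => App (lift k t) (lift k u)
  | Cst c => Cst c
  end.

Fixpoint subst (k : nat) (u t : tm) : tm :=
  match t with
  | Var i => match Nat.compare i k with
             | Lt => Var i
             | Eq => u
             | Gt => Var (pred i)
             end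
  | Univ n => Univ n
  | Pi A B => Pi (subst k u A) (subst (S k) (lift 0 u) B)
  | Lam b => Lam (subst (S k) (lift 0 u) b)
  | App t t' => App (subst k u t) (subst k u t')
  | Cst c => Cst c
  end.

Definition apps (t : tm) (us : list tm) : tm := fold_left App us t.

(** An [expr] is a term waiting for the number of binders above it; a bound
    variable introduced under [d] binders is [Var (d' - S d)] when used under
    [d'] binders.  This gives closed terms with named variables, and macros
    that never mention lifting. *)

Definition expr : Set := nat -> tm.

Definition close (e : expr) : tm := e 0.

Definition bvar (d : nat) : expr := fun d' => Var (d' - S d).
Definition pi (A : expr) (B : expr -> expr) : expr :=
  fun d => Pi (A d) (B (bvar d) (S d)).
Definition lam (b : expr -> expr) : expr := fun d => Lam (b (bvar d) (S d)).
Definition happ (t u : expr) : expr := fun d => App (t d) (u d).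
Definition univ (n : nat) : expr := fun _ => Univ n.
Definition const (c : cst) : expr := fun _ => Cst c.

Declare Scope hott_scope.
Delimit Scope hott_scope with hott.
Bind Scope hott_scope with expr.

Notation "'Π' x : A , B" := (pi A (fun x => B))
  (at level 200, x name, A at level 99, right associativity) : hott_scope.
Notation "'λ' x , b" := (lam (fun x => b))
  (at level 200, x name, right associativity) : hott_scope.
Notation "t ⋅ u" := (happ t u) (at level 40, left associativity) : hott_scope.
Notation "A ⇒ B" := (pi A (fun _ => B))
  (at level 99, right associativity, B at level 200) : hott_scope.

Local Open Scope hott_scope.

Definition hsig (n : nat) (A : expr) (B : expr -> expr) : expr :=
  const (cSig n) ⋅ A ⋅ (λ x, B x).
Definition hprod (n : nat) (A B : expr) : expr := hsig n A (fun _ => B).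
Definition hpair (n : nat) (A : expr) (B : expr -> expr) (a b : expr) : expr :=
  const (cPair n) ⋅ A ⋅ (λ x, B x) ⋅ a ⋅ b.

Definition hsum (n : nat) (A B : expr) : expr := const (cSum n) ⋅ A ⋅ B.
Definition hinl (n : nat) (A B a : expr) : expr := const (cInl n) ⋅ A ⋅ B ⋅ a.
Definition hinr (n : nat) (A B b : expr) : expr := const (cInr n) ⋅ A ⋅ B ⋅ b.

Definition hid (n : nat) (A a b : expr) : expr := const (cId n) ⋅ A ⋅ a ⋅ b.
Definition hrefl (n : nat) (A a : expr) : expr := const (cRefl n) ⋅ A ⋅ a.

(** For [A] of level [n], [D : A ⇒ univ m], [p : hid n A a b], [u : D ⋅ a]. *)
Definition transport (n m : nat) (A D a b p u : expr) : expr :=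
  const (cJ n m) ⋅ A ⋅ a ⋅ (λ y, λ _, D ⋅ y) ⋅ u ⋅ b ⋅ p.

(** For [s : Π x : A, D ⋅ x]; its type is
    [hid m (D ⋅ b) (transport n m A D a b p (s ⋅ a)) (s ⋅ b)]. *)
Definition apd (n m : nat) (A D s a b p : expr) : expr :=
  const (cJ n m) ⋅ A ⋅ a
    ⋅ (λ y, λ q, hid m (D ⋅ y) (transport n m A D a y q (s ⋅ a)) (s ⋅ y))
    ⋅ hrefl m (D ⋅ a) (s ⋅ a) ⋅ b ⋅ p.

Definition right_inv (n : nat) (A B f : expr) : expr :=
  hsig n (B ⇒ A) (fun h => Π b : B, hid n B (f ⋅ (h ⋅ b)) b).
Definition left_inv (n : nat) (A B f : expr) : expr :=
  hsig n (B ⇒ A) (fun h => Π a : A, hid n A (h ⋅ (f ⋅ a)) a).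

Definition is_equiv (n : nat) (A B f : expr) : expr :=
  hprod n (right_inv n A B f) (left_inv n A B f).
Definition equiv (n : nat) (A B : expr) : expr :=
  hsig n (A ⇒ B) (fun f => is_equiv n A B f).

Definition id_equiv (n : nat) (A : expr) : expr :=
  let i := λ x, x in
  let h := λ x, hrefl n A x in
  hpair n (A ⇒ A) (fun f => is_equiv n A A f) i
    (hpair n (right_inv n A A i) (fun _ => left_inv n A A i)
      (hpair n (A ⇒ A) (fun k => Π b : A, hid n A (i ⋅ (k ⋅ b)) b) i h)
      (hpair n (A ⇒ A) (fun k => Π a : A, hid n A (k ⋅ (i ⋅ a)) a) i h)).

Definition id_to_equiv (n : nat) (A B p : expr) : expr :=
  const (cJ (S n) n) ⋅ univ n ⋅ A ⋅ (λ Y, λ _, equiv n A Y)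
    ⋅ id_equiv n A ⋅ B ⋅ p.

Record span : Set := Span { sL : expr; sM : expr; sN : expr;
                            sf : expr; sg : expr }.

Definition pi_span (n : nat) (k : span -> expr) : expr :=
  Π L : univ n, Π M : univ n, Π N : univ n, Π f : (L ⇒ M), Π g : (L ⇒ N),
    k (Span L M N f g).

Definition app_span (c : cst) (s : span) : expr :=
  const c ⋅ sL s ⋅ sM s ⋅ sN s ⋅ sf s ⋅ sg s.

Definition po (n : nat) (s : span) : expr := app_span (cPO n) s.
Definition po_inl (n : nat) (s : span) (a : expr) : expr :=
  app_span (cPOinl n) s ⋅ a.
Definition po_inr (n : nat) (s : span) (b : expr) : expr :=
  app_span (cPOinr n) s ⋅ b.
Definition po_glue (n : nat) (s : span) (l : expr) : expr :=
  app_span (cPOglue n) s ⋅ l.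

Definition po_in (n : nat) (s : span) (x : expr) : expr :=
  const (cSumInd n n) ⋅ sM s ⋅ sN s ⋅ (λ _, po n s)
    ⋅ (λ a, po_inl n s a) ⋅ (λ b, po_inr n s b) ⋅ x.

Record po_methods : Set := POMethods { pD : expr; pinl : expr; pinr : expr;
                                       pglue : expr }.

Definition pi_po_methods (n m : nat) (s : span) (k : po_methods -> expr)
  : expr :=
  Π D : (po n s ⇒ univ m),
  Π dl : (Π a : sM s, D ⋅ po_inl n s a),
  Π dr : (Π b : sN s, D ⋅ po_inr n s b),
  Π dg : (Π l : sL s,
            hid m (D ⋅ po_inr n s (sg s ⋅ l))
              (transport n m (po n s) D
                 (po_inl n s (sf s ⋅ l)) (po_inr n s (sg s ⋅ l))
                 (po_glue n s l) (dl ⋅ (sf s ⋅ l)))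
              (dr ⋅ (sg s ⋅ l))),
    k (POMethods D dl dr dg).

Definition po_ind (n m : nat) (s : span) (e : po_methods) (p : expr) : expr :=
  app_span (cPOind n m) s ⋅ pD e ⋅ pinl e ⋅ pinr e ⋅ pglue e ⋅ p.

Definition vertices (n : nat) (s : span) : expr := hsum n (sM s) (sN s).
Definition vf (n : nat) (s : span) (l : expr) : expr :=
  hinl n (sM s) (sN s) (sf s ⋅ l).
Definition vg (n : nat) (s : span) (l : expr) : expr :=
  hinr n (sM s) (sN s) (sg s ⋅ l).

(** The base point [x] is a parameter, [y] is the index. *)
Definition C (n : nat) (s : span) (x y : expr) : expr :=
  app_span (cC n) s ⋅ x ⋅ y.
Definition C_nil (n : nat) (s : span) (x : expr) : expr :=
  app_span (cNil n) s ⋅ x.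
Definition C_gl (n : nat) (s : span) (x l z : expr) : expr :=
  app_span (cGl n) s ⋅ x ⋅ l ⋅ z.
Definition C_linv (n : nat) (s : span) (x l w : expr) : expr :=
  app_span (cLinv n) s ⋅ x ⋅ l ⋅ w.
Definition C_leq (n : nat) (s : span) (x l z : expr) : expr :=
  app_span (cLeq n) s ⋅ x ⋅ l ⋅ z.
Definition C_rinv (n : nat) (s : span) (x l w : expr) : expr :=
  app_span (cRinv n) s ⋅ x ⋅ l ⋅ w.
Definition C_req (n : nat) (s : span) (x l w : expr) : expr :=
  app_span (cReq n) s ⋅ x ⋅ l ⋅ w.

Record C_methods : Set := CMethods { cD : expr; cnil : expr; cgl : expr;
  clinv : expr; cleq : expr; crinv : expr; creq : expr }.

Definition pi_C_methods (n m : nat) (s : span) (x : expr)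
  (k : C_methods -> expr) : expr :=
  Π D : (Π y : vertices n s, C n s x y ⇒ univ m),
  Π dnil : D ⋅ x ⋅ C_nil n s x,
  Π dgl : (Π l : sL s, Π z : C n s x (vf n s l),
             D ⋅ vf n s l ⋅ z ⇒ D ⋅ vg n s l ⋅ C_gl n s x l z),
  Π dlinv : (Π l : sL s, Π w : C n s x (vg n s l),
               D ⋅ vg n s l ⋅ w ⇒ D ⋅ vf n s l ⋅ C_linv n s x l w),
  Π dleq : (Π l : sL s, Π z : C n s x (vf n s l), Π d : D ⋅ vf n s l ⋅ z,
              hid m (D ⋅ vf n s l ⋅ z)
                (transport n m (C n s x (vf n s l)) (D ⋅ vf n s l)
                   (C_linv n s x l (C_gl n s x l z)) z (C_leq n s x l z)
                   (dlinv ⋅ l ⋅ C_gl n s x l z ⋅ (dgl ⋅ l ⋅ z ⋅ d)))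
                d),
  Π drinv : (Π l : sL s, Π w : C n s x (vg n s l),
               D ⋅ vg n s l ⋅ w ⇒ D ⋅ vf n s l ⋅ C_rinv n s x l w),
  Π dreq : (Π l : sL s, Π w : C n s x (vg n s l), Π d : D ⋅ vg n s l ⋅ w,
              hid m (D ⋅ vg n s l ⋅ w)
                (transport n m (C n s x (vg n s l)) (D ⋅ vg n s l)
                   (C_gl n s x l (C_rinv n s x l w)) w (C_req n s x l w)
                   (dgl ⋅ l ⋅ C_rinv n s x l w ⋅ (drinv ⋅ l ⋅ w ⋅ d)))
                d),
    k (CMethods D dnil dgl dlinv dleq drinv dreq).

Definition C_ind (n m : nat) (s : span) (x : expr) (e : C_methods)
  (y c : expr) : expr :=
  app_span (cCind n m) s ⋅ x ⋅ cD e ⋅ cnil e ⋅ cgl e ⋅ clinv e ⋅ cleq e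
    ⋅ crinv e ⋅ creq e ⋅ y ⋅ c.

Definition cst_type (c : cst) : expr :=
  match c with
  | cSig n => Π A : univ n, (A ⇒ univ n) ⇒ univ n
  | cPair n => Π A : univ n, Π B : (A ⇒ univ n),
      Π a : A, B ⋅ a ⇒ hsig n A (fun x => B ⋅ x)
  | cSigInd n m => Π A : univ n, Π B : (A ⇒ univ n),
      Π D : (hsig n A (fun x => B ⋅ x) ⇒ univ m),
      (Π a : A, Π b : B ⋅ a, D ⋅ hpair n A (fun x => B ⋅ x) a b) ⇒
      Π p : hsig n A (fun x => B ⋅ x), D ⋅ p

  | cSum n => univ n ⇒ univ n ⇒ univ n
  | cInl n => Π A : univ n, Π B : univ n, A ⇒ hsum n A B
  | cInr n => Π A : univ n, Π B : univ n, B ⇒ hsum n A B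
  | cSumInd n m => Π A : univ n, Π B : univ n, Π D : (hsum n A B ⇒ univ m),
      (Π a : A, D ⋅ hinl n A B a) ⇒ (Π b : B, D ⋅ hinr n A B b) ⇒
      Π p : hsum n A B, D ⋅ p

  | cId n => Π A : univ n, A ⇒ A ⇒ univ n
  | cRefl n => Π A : univ n, Π a : A, hid n A a a
  | cJ n m => Π A : univ n, Π a : A, Π D : (Π b : A, hid n A a b ⇒ univ m),
      D ⋅ a ⋅ hrefl n A a ⇒ Π b : A, Π p : hid n A a b, D ⋅ b ⋅ p

  | cUnivalence n => Π A : univ n, Π B : univ n,
      is_equiv (S n) (hid (S n) (univ n) A B) (equiv n A B)
        (λ p, id_to_equiv n A B p)

  | cPO n => pi_span n (fun s => univ n)
  | cPOinl n => pi_span n (fun s => sM s ⇒ po n s)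
  | cPOinr n => pi_span n (fun s => sN s ⇒ po n s)
  | cPOglue n => pi_span n (fun s => Π l : sL s,
      hid n (po n s) (po_inl n s (sf s ⋅ l)) (po_inr n s (sg s ⋅ l)))
  | cPOind n m => pi_span n (fun s => pi_po_methods n m s (fun e =>
      Π p : po n s, pD e ⋅ p))
  | cPOindGlue n m => pi_span n (fun s => pi_po_methods n m s (fun e =>
      Π l : sL s,
      let a := po_inl n s (sf s ⋅ l) in
      let b := po_inr n s (sg s ⋅ l) in
      hid m (hid m (pD e ⋅ b)
             (transport n m (po n s) (pD e) a b (po_glue n s l)
                (pinl e ⋅ (sf s ⋅ l)))
             (pinr e ⋅ (sg s ⋅ l)))
        (apd n m (po n s) (pD e) (λ p, po_ind n m s e p) a b (po_glue n s l))
        (pglue e ⋅ l)))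

  | cC n => pi_span n (fun s => vertices n s ⇒ vertices n s ⇒ univ n)
  | cNil n => pi_span n (fun s => Π x : vertices n s, C n s x x)
  | cGl n => pi_span n (fun s => Π x : vertices n s, Π l : sL s,
      C n s x (vf n s l) ⇒ C n s x (vg n s l))
  | cLinv n => pi_span n (fun s => Π x : vertices n s, Π l : sL s,
      C n s x (vg n s l) ⇒ C n s x (vf n s l))
  | cLeq n => pi_span n (fun s => Π x : vertices n s, Π l : sL s,
      Π z : C n s x (vf n s l),
      hid n (C n s x (vf n s l)) (C_linv n s x l (C_gl n s x l z)) z)
  | cRinv n => pi_span n (fun s => Π x : vertices n s, Π l : sL s,
      C n s x (vg n s l) ⇒ C n s x (vf n s l))
  | cReq n => pi_span n (fun s => Π x : vertices n s, Π l : sL s,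
      Π w : C n s x (vg n s l),
      hid n (C n s x (vg n s l)) (C_gl n s x l (C_rinv n s x l w)) w)
  | cCind n m => pi_span n (fun s => Π x : vertices n s,
      pi_C_methods n m s x (fun e =>
      Π y : vertices n s, Π c : C n s x y, cD e ⋅ y ⋅ c))
  | cCindLeq n m => pi_span n (fun s => Π x : vertices n s,
      pi_C_methods n m s x (fun e =>
      Π l : sL s, Π z : C n s x (vf n s l),
      let y := vf n s l in
      let z' := C_linv n s x l (C_gl n s x l z) in
      hid m (hid m (cD e ⋅ y ⋅ z)
             (transport n m (C n s x y) (cD e ⋅ y) z' z (C_leq n s x l z)
                (C_ind n m s x e y z'))
             (C_ind n m s x e y z))
        (apd n m (C n s x y) (cD e ⋅ y) (λ c, C_ind n m s x e y c)
           z' z (C_leq n s x l z))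
        (cleq e ⋅ l ⋅ z ⋅ C_ind n m s x e y z)))
  | cCindReq n m => pi_span n (fun s => Π x : vertices n s,
      pi_C_methods n m s x (fun e =>
      Π l : sL s, Π w : C n s x (vg n s l),
      let y := vg n s l in
      let w' := C_gl n s x l (C_rinv n s x l w) in
      hid m (hid m (cD e ⋅ y ⋅ w)
             (transport n m (C n s x y) (cD e ⋅ y) w' w (C_req n s x l w)
                (C_ind n m s x e y w'))
             (C_ind n m s x e y w))
        (apd n m (C n s x y) (cD e ⋅ y) (λ c, C_ind n m s x e y c)
           w' w (C_req n s x l w))
        (creq e ⋅ l ⋅ w ⋅ C_ind n m s x e y w)))
  end.

(** Defining equations of the eliminators at point constructors; [s] lists the
    components of a span, [e] the motive and the methods.  Computation at the
    path constructors is propositional, given by [cPOindGlue], [cCindLeq] and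
    [cCindReq]. *)
Inductive computes : tm -> tm -> Prop :=
  | comp_sig n m A B D d a b :
      computes
        (apps (Cst (cSigInd n m)) [A; B; D; d; apps (Cst (cPair n)) [A; B; a; b]])
        (apps d [a; b])
  | comp_inl n m A B D d d' a :
      computes
        (apps (Cst (cSumInd n m)) [A; B; D; d; d'; apps (Cst (cInl n)) [A; B; a]])
        (App d a)
  | comp_inr n m A B D d d' b :
      computes
        (apps (Cst (cSumInd n m)) [A; B; D; d; d'; apps (Cst (cInr n)) [A; B; b]])
        (App d' b)
  | comp_J n m A a D d :
      computes
        (apps (Cst (cJ n m)) [A; a; D; d; a; apps (Cst (cRefl n)) [A; a]])
        d
  | comp_po_inl n m L M N f g D dl dr dg a :
      let s := [L; M; N; f; g] in
      let e := [D; dl; dr; dg] in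
      computes
        (apps (Cst (cPOind n m)) (s ++ e ++ [apps (Cst (cPOinl n)) (s ++ [a])]))
        (App dl a)
  | comp_po_inr n m L M N f g D dl dr dg b :
      let s := [L; M; N; f; g] in
      let e := [D; dl; dr; dg] in
      computes
        (apps (Cst (cPOind n m)) (s ++ e ++ [apps (Cst (cPOinr n)) (s ++ [b])]))
        (App dr b)
  | comp_nil n m L M N f g x D dnil dgl dlinv dleq drinv dreq :
      let s := [L; M; N; f; g] in
      let e := [D; dnil; dgl; dlinv; dleq; drinv; dreq] in
      computes
        (apps (Cst (cCind n m))
           (s ++ [x] ++ e ++ [x; apps (Cst (cNil n)) (s ++ [x])]))
        dnil
  | comp_gl n m L M N f g x D dnil dgl dlinv dleq drinv dreq l z :
      let s := [L; M; N; f; g] in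
      let e := [D; dnil; dgl; dlinv; dleq; drinv; dreq] in
      let vf := apps (Cst (cInl n)) [M; N; App f l] in
      let vg := apps (Cst (cInr n)) [M; N; App g l] in
      let ind y c := apps (Cst (cCind n m)) (s ++ [x] ++ e ++ [y; c]) in
      computes
        (ind vg (apps (Cst (cGl n)) (s ++ [x; l; z])))
        (apps dgl [l; z; ind vf z])
  | comp_linv n m L M N f g x D dnil dgl dlinv dleq drinv dreq l w :
      let s := [L; M; N; f; g] in
      let e := [D; dnil; dgl; dlinv; dleq; drinv; dreq] in
      let vf := apps (Cst (cInl n)) [M; N; App f l] in
      let vg := apps (Cst (cInr n)) [M; N; App g l] in
      let ind y c := apps (Cst (cCind n m)) (s ++ [x] ++ e ++ [y; c]) in
      computes
        (ind vf (apps (Cst (cLinv n)) (s ++ [x; l; w])))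
        (apps dlinv [l; w; ind vg w])
  | comp_rinv n m L M N f g x D dnil dgl dlinv dleq drinv dreq l w :
      let s := [L; M; N; f; g] in
      let e := [D; dnil; dgl; dlinv; dleq; drinv; dreq] in
      let vf := apps (Cst (cInl n)) [M; N; App f l] in
      let vg := apps (Cst (cInr n)) [M; N; App g l] in
      let ind y c := apps (Cst (cCind n m)) (s ++ [x] ++ e ++ [y; c]) in
      computes
        (ind vf (apps (Cst (cRinv n)) (s ++ [x; l; w])))
        (apps drinv [l; w; ind vg w]).

(** Convertibility: the congruence generated by beta, eta for functions and
    the defining equations. *)
Inductive conv : tm -> tm -> Prop :=
  | conv_refl t : conv t t
  | conv_sym t u : conv t u -> conv u t
  | conv_trans t u v : conv t u -> conv u v -> conv t v
  | conv_pi A A' B B' : conv A A' -> conv B B' -> conv (Pi A B) (Pi A' B')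
  | conv_lam b b' : conv b b' -> conv (Lam b) (Lam b')
  | conv_app t t' u u' : conv t t' -> conv u u' -> conv (App t u) (App t' u')
  | conv_beta b u : conv (App (Lam b) u) (subst 0 u b)
  | conv_eta t : conv (Lam (App (lift 0 t) (Var 0))) t
  | conv_comp t u : computes t u -> conv t u.

Inductive lookup : list tm -> nat -> tm -> Prop :=
  | lookup_here Γ A : lookup (A :: Γ) 0 (lift 0 A)
  | lookup_there Γ A B i :
      lookup Γ i A -> lookup (B :: Γ) (S i) (lift 0 A).

(** Contexts are extended only by types already derived to be types, so every
    context in a derivation rooted at the empty context is well-formed and no
    separate judgment is needed for that. *)
Inductive typing : list tm -> tm -> tm -> Prop :=
  | ty_var Γ i A : lookup Γ i A -> typing Γ (Var i) A
  | ty_cst Γ c : typing Γ (Cst c) (close (cst_type c))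
  | ty_univ Γ n : typing Γ (Univ n) (Univ (S n))
  | ty_cumul Γ A n : typing Γ A (Univ n) -> typing Γ A (Univ (S n))
  | ty_pi Γ A B n :
      typing Γ A (Univ n) -> typing (A :: Γ) B (Univ n) ->
      typing Γ (Pi A B) (Univ n)
  | ty_lam Γ A B b n :
      typing Γ A (Univ n) -> typing (A :: Γ) b B ->
      typing Γ (Lam b) (Pi A B)
  | ty_app Γ A B t u :
      typing Γ t (Pi A B) -> typing Γ u A ->
      typing Γ (App t u) (subst 0 u B)
  | ty_conv Γ t A B n :
      typing Γ t A -> typing Γ B (Univ n) -> conv A B -> typing Γ t B.

(** A closed type is a theorem of the system when it has a closed term. *)
Definition derivable (A : expr) : Prop := exists t, typing [] t (close A).

(* Main.v *)
From Stdlib Require Import List Lia PeanoNat Bool.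
Require Import Defs.
Import ListNotations.

(** The theorem asks for a closed term of the formal system.  The idea of that
    term is an encode-decode argument.  Fix the base point [x] and write [P] for
    the pushout.  By pushout recursion into the universe, with univalence
    applied to the equivalences [gl] at the paths [glue], there is a family
    [code] over [P] whose value at [in y] is [C x y]; transport of [nil] in it
    gives [encode b : in x = b -> code b].

    - Right inverse.  The induction principle of [C] gives, for every
      [z : C x y], a path [p : in x = in y] with [encode p = z]
      ([find_preimage_entry]).  The difficulty is in the path constructors
      [leq] and [req] of [C], since the motive is not a family of propositions.
      It disappears when [gl] is known to be transport along [glue] by a path
      between functions and not just pointwise ([descent_entry]).  The pair of
      [glue] and that path is an [edge], and path induction replaces an
      arbitrary edge by an identity map over a constant path ([edge_elim]).  For
      the identity of [X], a left or a right inverse is a map [h] with paths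
      [h z = z], and both it and these paths lift to any family over [X] by
      transport ([identity_inverse_lift]), so no coherence of [h] is needed.

    - Left inverse.  To prove [decode (encode p) = p] by path induction, [decode]
      must be defined at every point of [P], hence by pushout induction.  At
      [in y] it is the path found above; at [glue] a path between transported
      functions is needed, which comes from function extensionality
      ([transport_function_entry]), itself derived from univalence
      ([funext_entry]).  The two inverses of [encode] need not be compared, as
      equivalences are bi-invertible maps.

    The derivation itself is found by computation.  A type checker for the
    system is defined and proved sound ([checker_sound]); it reads a list of
    definitions and lemmas, each of which may use the earlier ones by name
    ([proves_sound]).  Its soundness rests on the weakening and substitution
    properties of derivations, but on neither confluence nor subject reduction:
    whenever a type is reduced in order to expose a product, the product is
    checked again.  The levels in the checked terms are the numerals 0 and 1,
    and adding [n] to all levels preserves derivations ([raise_typing]). *)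

(** * Lifting and substitution *)

(** Succeeds on terms without case analysis: comparisons are split innermost
    first. *)
Ltac is_atom e := lazymatch e with
  | context [if _ then _ else _] => fail
  | context [match _ with _ => _ end] => fail
  | _ => idtac end.
Ltac var_cases := intros; cbn [lift subst];
  repeat (match goal with
  | |- context [Nat.leb ?a ?b] => is_atom a; is_atom b; destruct (Nat.leb_spec a b)
  | |- context [Nat.compare ?a ?b] =>
      is_atom a; is_atom b; destruct (Nat.compare_spec a b)
  end; subst; cbn [lift subst]);
  try (exfalso; lia); try (f_equal; lia); auto.

Lemma lift_lift t : forall i k, i <= k -> lift i (lift k t) = lift (S k) (lift i t).
Proof.
  induction t; intros i' k H; [var_cases | simpl; f_equal; auto with arith ..].
Qed.

Lemma subst_lift t : forall k u, subst k u (lift k t) = t.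
Proof.
  induction t; intros k u; [var_cases | simpl; f_equal; auto ..].
Qed.

Lemma lift_subst_le t : forall k j u, k <= j ->
  lift k (subst j u t) = subst (S j) (lift k u) (lift k t).
Proof.
  induction t; intros k j u H; [var_cases | simpl; f_equal; auto ..].
  - rewrite IHt2, (lift_lift u 0 k) by lia. reflexivity.
  - rewrite IHt, (lift_lift u 0 k) by lia. reflexivity.
Qed.

Lemma lift_subst_ge t : forall k j u, j <= k ->
  lift k (subst j u t) = subst j (lift k u) (lift (S k) t).
Proof.
  induction t; intros k j u H; [var_cases | simpl; f_equal; auto ..].
  - rewrite IHt2, (lift_lift u 0 k) by lia. reflexivity.
  - rewrite IHt, (lift_lift u 0 k) by lia. reflexivity.
Qed.

Lemma subst_subst t : forall i j u v, i <= j ->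
  subst j v (subst i u t) = subst i (subst j v u) (subst (S j) (lift i v) t).
Proof.
  induction t; intros i' j u v H;
    [var_cases; rewrite ?subst_lift; auto | simpl; f_equal; auto ..].
  - rewrite IHt2, (lift_subst_le u 0 j), (lift_lift v 0 i') by lia. reflexivity.
  - rewrite IHt, (lift_subst_le u 0 j), (lift_lift v 0 i') by lia. reflexivity.
Qed.

Lemma lift_cst_type k c : lift k (close (cst_type c)) = close (cst_type c).
Proof. destruct c; reflexivity. Qed.

Lemma subst_cst_type k u c : subst k u (close (cst_type c)) = close (cst_type c).
Proof. destruct c; reflexivity. Qed.

Lemma computes_lift k t u : computes t u -> computes (lift k t) (lift k u).
Proof. destruct 1; simpl; constructor. Qed.

Lemma computes_subst k v t u : computes t u -> computes (subst k v t) (subst k v u).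
Proof. destruct 1; simpl; constructor. Qed.

Lemma conv_lift t u : conv t u -> forall k, conv (lift k t) (lift k u).
Proof.
  induction 1; intro k; simpl; eauto using conv, computes_lift.
  - rewrite lift_subst_ge by lia. apply conv_beta.
  - rewrite <- lift_lift by lia. apply conv_eta.
Qed.

Lemma conv_subst t u : conv t u -> forall k w, conv (subst k w t) (subst k w u).
Proof.
  induction 1; intros k w; simpl; eauto using conv, computes_subst.
  - rewrite subst_subst by lia. apply conv_beta.
  - rewrite <- lift_subst_le by lia. apply conv_eta.
Qed.

(** * Weakening and substitution of derivations *)

(** [insertion A k Γ Γ'] generalizes the extension of a context by [A] so that
    an induction on derivations goes under binders. *)
Inductive insertion (A : tm) : nat -> list tm -> list tm -> Prop :=
  | insertion_here Γ : insertion A 0 Γ (A :: Γ)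
  | insertion_under k Γ Γ' B :
      insertion A k Γ Γ' -> insertion A (S k) (B :: Γ) (lift k B :: Γ').

Lemma insertion_lookup A k Γ Γ' : insertion A k Γ Γ' ->
  forall i T, lookup Γ i T ->
  lookup Γ' (if Nat.leb k i then S i else i) (lift k T).
Proof.
  induction 1; intros i T Hi.
  - simpl. constructor. exact Hi.
  - inversion Hi; subst.
    + rewrite <- lift_lift by lia. simpl. constructor.
    + rewrite <- lift_lift by lia. simpl.
      match goal with Hl : lookup Γ ?j _ |- _ =>
        apply IHinsertion in Hl; destruct (Nat.leb k j) end;
      constructor; assumption.
Qed.

Lemma typing_lift Γ t T : typing Γ t T -> forall A k Γ',
  insertion A k Γ Γ' -> typing Γ' (lift k t) (lift k T).
Proof.
  induction 1; intros A' k Γ' Hins; simpl.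
  - apply ty_var. eapply insertion_lookup; eassumption.
  - rewrite lift_cst_type. apply ty_cst.
  - apply ty_univ.
  - apply ty_cumul, (IHtyping _ _ _ Hins).
  - apply ty_pi; [apply (IHtyping1 _ _ _ Hins)|].
    apply (IHtyping2 A' (S k)). constructor. exact Hins.
  - apply ty_lam with n; [apply (IHtyping1 _ _ _ Hins)|].
    apply (IHtyping2 A' (S k)). constructor. exact Hins.
  - rewrite lift_subst_ge by lia. apply ty_app with (lift k A).
    + apply (IHtyping1 _ _ _ Hins).
    + apply (IHtyping2 _ _ _ Hins).
  - apply ty_conv with (lift k A) n.
    + apply (IHtyping1 _ _ _ Hins).
    + apply (IHtyping2 _ _ _ Hins).
    + apply conv_lift. assumption.
Qed.

Corollary weakening Γ A t T : typing Γ t T -> typing (A :: Γ) (lift 0 t) (lift 0 T).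
Proof. intro H. eapply typing_lift; [exact H | constructor]. Qed.

(** The analogue of [insertion] for substitution: the variable [k] of [Γ] is
    replaced by [u]. *)
Inductive instantiation : nat -> tm -> list tm -> list tm -> Prop :=
  | instantiation_here Γ A u : typing Γ u A -> instantiation 0 u (A :: Γ) Γ
  | instantiation_under k u Γ Γ' B : instantiation k u Γ Γ' ->
      instantiation (S k) (lift 0 u) (B :: Γ) (subst k u B :: Γ').

Lemma instantiation_lookup k u Γ Γ' : instantiation k u Γ Γ' ->
  forall i T, lookup Γ i T -> typing Γ' (subst k u (Var i)) (subst k u T).
Proof.
  induction 1; intros i T Hi; inversion Hi; subst.
  - rewrite subst_lift. exact H.
  - rewrite subst_lift. simpl. apply ty_var. assumption.
  - rewrite <- lift_subst_le by lia. simpl. apply ty_var. constructor.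
  - rewrite <- lift_subst_le by lia.
    match goal with Hl : lookup Γ ?j _ |- _ => change (Var (S j)) with (lift 0 (Var j)) end.
    rewrite <- lift_subst_le by lia. apply weakening. auto.
Qed.

Lemma typing_subst Γ t T : typing Γ t T -> forall k u Γ',
  instantiation k u Γ Γ' -> typing Γ' (subst k u t) (subst k u T).
Proof.
  induction 1; intros k v Γ' Hins; simpl.
  - apply (instantiation_lookup _ _ _ _ Hins). assumption.
  - rewrite subst_cst_type. apply ty_cst.
  - apply ty_univ.
  - apply ty_cumul, (IHtyping _ _ _ Hins).
  - apply ty_pi; [apply (IHtyping1 _ _ _ Hins)|].
    apply (IHtyping2 (S k)). constructor. exact Hins.
  - apply ty_lam with n; [apply (IHtyping1 _ _ _ Hins)|].
    apply (IHtyping2 (S k)). constructor. exact Hins.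
  - rewrite subst_subst by lia. apply ty_app with (subst k v A).
    + apply (IHtyping1 _ _ _ Hins).
    + apply (IHtyping2 _ _ _ Hins).
  - apply ty_conv with (subst k v A) n.
    + apply (IHtyping1 _ _ _ Hins).
    + apply (IHtyping2 _ _ _ Hins).
    + apply conv_subst. assumption.
Qed.

Definition is_type (Γ : list tm) (A : tm) : Prop := exists n, typing Γ A (Univ n).

Inductive wf : list tm -> Prop :=
  | wf_nil : wf []
  | wf_cons Γ A : wf Γ -> is_type Γ A -> wf (A :: Γ).

Lemma is_type_weakening Γ A B : is_type Γ A -> is_type (B :: Γ) (lift 0 A).
Proof. intros [n H]. exists n. apply (weakening _ _ _ _ H). Qed.

Lemma is_type_lookup Γ i A : wf Γ -> lookup Γ i A -> is_type Γ A.
Proof.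
  intros Hwf Hi. induction Hi; inversion Hwf; subst;
    apply is_type_weakening; auto.
Qed.

Lemma is_type_subst Γ A B u : typing Γ u A -> is_type (A :: Γ) B ->
  is_type Γ (subst 0 u B).
Proof.
  intros Hu [n HB]. exists n.
  apply (typing_subst _ _ _ HB 0 u). constructor. exact Hu.
Qed.

Lemma typing_cumul Γ A i j : i <= j -> typing Γ A (Univ i) -> typing Γ A (Univ j).
Proof. induction 1; auto using ty_cumul. Qed.

Lemma is_type_pi Γ A B : is_type Γ A -> is_type (A :: Γ) B -> is_type Γ (Pi A B).
Proof.
  intros [i HA] [j HB]. exists (Nat.max i j).
  apply ty_pi; eapply typing_cumul; try eassumption; lia.
Qed.

(** Inversion of the rule for products does not need injectivity of products
    up to conversion: cumulativity and conversion only change the universe. *)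
Lemma is_type_pi_inv Γ A B : is_type Γ (Pi A B) ->
  is_type Γ A /\ is_type (A :: Γ) B.
Proof.
  intros [n H]. remember (Pi A B) as T eqn:E.
  induction H; inversion E; subst; auto. split; eexists; eassumption.
Qed.

Lemma typing_conv Γ t A B : typing Γ t A -> is_type Γ B -> conv A B -> typing Γ t B.
Proof. intros H [n HB] E. exact (ty_conv _ _ _ _ _ H HB E). Qed.

(** * Raising universe levels *)

Definition raise_cst (n : nat) (c : cst) : cst :=
  match c with
  | cSig i => cSig (i + n) | cPair i => cPair (i + n)
  | cSigInd i m => cSigInd (i + n) (m + n)
  | cSum i => cSum (i + n) | cInl i => cInl (i + n) | cInr i => cInr (i + n)
  | cSumInd i m => cSumInd (i + n) (m + n)
  | cId i => cId (i + n) | cRefl i => cRefl (i + n)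
  | cJ i m => cJ (i + n) (m + n)
  | cUnivalence i => cUnivalence (i + n)
  | cPO i => cPO (i + n) | cPOinl i => cPOinl (i + n)
  | cPOinr i => cPOinr (i + n) | cPOglue i => cPOglue (i + n)
  | cPOind i m => cPOind (i + n) (m + n)
  | cPOindGlue i m => cPOindGlue (i + n) (m + n)
  | cC i => cC (i + n) | cNil i => cNil (i + n) | cGl i => cGl (i + n)
  | cLinv i => cLinv (i + n) | cLeq i => cLeq (i + n)
  | cRinv i => cRinv (i + n) | cReq i => cReq (i + n)
  | cCind i m => cCind (i + n) (m + n)
  | cCindLeq i m => cCindLeq (i + n) (m + n)
  | cCindReq i m => cCindReq (i + n) (m + n)
  end.

Fixpoint raise (n : nat) (t : tm) : tm :=
  match t with
  | Var i => Var i
  | Univ i => Univ (i + n)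
  | Pi A B => Pi (raise n A) (raise n B)
  | Lam b => Lam (raise n b)
  | App t u => App (raise n t) (raise n u)
  | Cst c => Cst (raise_cst n c)
  end.

Lemma raise_lift n t : forall k, raise n (lift k t) = lift k (raise n t).
Proof. induction t; intro k; simpl; f_equal; auto. Qed.

Lemma raise_subst n t : forall k u,
  raise n (subst k u t) = subst k (raise n u) (raise n t).
Proof.
  induction t; intros k u; simpl; rewrite <- ?raise_lift; f_equal; auto.
  destruct (Nat.compare i k); reflexivity.
Qed.

Lemma raise_cst_type n c :
  raise n (close (cst_type c)) = close (cst_type (raise_cst n c)).
Proof. destruct c; reflexivity. Qed.

Lemma raise_computes n t u : computes t u -> computes (raise n t) (raise n u).
Proof. destruct 1; simpl; constructor. Qed.

Lemma raise_conv n t u : conv t u -> conv (raise n t) (raise n u).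
Proof.
  induction 1; simpl; eauto using conv, raise_computes.
  - rewrite raise_subst. apply conv_beta.
  - rewrite raise_lift. apply conv_eta.
Qed.

Lemma raise_typing n Γ t A : typing Γ t A ->
  typing (map (raise n) Γ) (raise n t) (raise n A).
Proof.
  induction 1; simpl in *; eauto using typing, raise_conv.
  - apply ty_var. induction H; simpl; rewrite raise_lift; constructor; assumption.
  - rewrite raise_cst_type. apply ty_cst.
  - rewrite raise_subst. eapply ty_app; eassumption.
Qed.

(** * Syntactic equality *)

(** The Boolean operations of the library evaluate both arguments under
    call by value, which would make the checker exponential. *)
Local Notation "a &&& b" := (if a then b else false) (at level 40, left associativity).
Local Notation "a ||| b" := (if a then true else b) (at level 50, left associativity).

Lemma and_then (a b : bool) : a &&& b = true -> a = true /\ b = true.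
Proof. destruct a; auto; discriminate. Qed.

Lemma or_else (a b : bool) : a ||| b = true -> a = true \/ b = true.
Proof. destruct a; auto; discriminate. Qed.

Definition cst_code (c : cst) : nat * nat * nat :=
  match c with
  | cSig n => (0, n, 0)
  | cPair n => (1, n, 0)
  | cSum n => (2, n, 0)
  | cInl n => (3, n, 0)
  | cInr n => (4, n, 0)
  | cId n => (5, n, 0)
  | cRefl n => (6, n, 0)
  | cUnivalence n => (7, n, 0)
  | cPO n => (8, n, 0)
  | cPOinl n => (9, n, 0)
  | cPOinr n => (10, n, 0)
  | cPOglue n => (11, n, 0)
  | cC n => (12, n, 0)
  | cNil n => (13, n, 0)
  | cGl n => (14, n, 0)
  | cLinv n => (15, n, 0)
  | cLeq n => (16, n, 0)
  | cRinv n => (17, n, 0)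
  | cReq n => (18, n, 0)
  | cSigInd n m => (19, n, m)
  | cSumInd n m => (20, n, m)
  | cJ n m => (21, n, m)
  | cPOind n m => (22, n, m)
  | cPOindGlue n m => (23, n, m)
  | cCind n m => (24, n, m)
  | cCindLeq n m => (25, n, m)
  | cCindReq n m => (26, n, m)
  end.

Definition cst_eqb (c d : cst) : bool :=
  let '(k, n, m) := cst_code c in
  let '(k', n', m') := cst_code d in
  (k =? k') &&& (n =? n') &&& (m =? m').

Fixpoint tm_eqb (t u : tm) : bool :=
  match t, u with
  | Var i, Var j => i =? j
  | Univ i, Univ j => i =? j
  | Pi A B, Pi A' B' => tm_eqb A A' &&& tm_eqb B B'
  | Lam b, Lam b' => tm_eqb b b'
  | App t u, App t' u' => tm_eqb t t' &&& tm_eqb u u'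
  | Cst c, Cst c' => cst_eqb c c'
  | _, _ => false
  end.

Lemma cst_eqb_eq c d : cst_eqb c d = true -> c = d.
Proof.
  unfold cst_eqb. intro H.
  destruct c, d; try discriminate H; simpl in H;
    apply and_then in H as [H1 H2]; apply Nat.eqb_eq in H1;
    try apply Nat.eqb_eq in H2; congruence.
Qed.

Ltac bools := repeat match goal with
  | H : _ &&& _ = true |- _ => apply and_then in H; destruct H
  | H : (_ =? _) = true |- _ => apply Nat.eqb_eq in H; subst
  | H : cst_eqb _ _ = true |- _ => apply cst_eqb_eq in H; subst
  end.

Lemma tm_eqb_eq t : forall u, tm_eqb t u = true -> t = u.
Proof.
  induction t; destruct u; simpl; intro H; try discriminate; bools; f_equal; auto.
Qed.

(** * Named definitions *)

(** Terms with all definitions expanded are too large to be checked, so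
    definitions are named; the names are constants for univalence at levels at
    which univalence is not used. *)
Definition name (i : nat) : cst := cUnivalence (S (S i)).

Definition named (c : cst) : option nat :=
  match c with cUnivalence (S (S i)) => Some i | _ => None end.

(** The entries of [ds] are themselves expanded. *)
Fixpoint expand (ds : list tm) (t : tm) : tm :=
  match t with
  | Pi A B => Pi (expand ds A) (expand ds B)
  | Lam b => Lam (expand ds b)
  | App t u => App (expand ds t) (expand ds u)
  | Cst c =>
      match named c with
      | Some i => nth i ds (Cst c)
      | None => Cst c
      end
  | _ => t
  end.

(** The checker unfolds only the transparent entries: lemmas, like those of a
    proof assistant, are used through their types. *)
Record entry : Set := Entry { etype : tm; ebody : tm; transparent : bool }.

Definition closed (t : tm) : Prop :=
  forall k, lift k t = t /\ forall u, subst k u t = t.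

Lemma typing_closed Γ t T : typing Γ t T -> forall k, length Γ <= k ->
  lift k t = t /\ forall u, subst k u t = t.
Proof.
  assert (Hvar : forall Γ i A, lookup Γ i A -> i < length Γ).
  { induction 1; simpl; lia. }
  induction 1; simpl in *; intros k Hk; auto.
  - apply Hvar in H. split; [|intro u].
    + destruct (Nat.leb_spec k i); [lia|reflexivity].
    + destruct (Nat.compare_spec i k); [lia|reflexivity|lia].
  - destruct (IHtyping1 k Hk) as [L1 S1], (IHtyping2 (S k)) as [L2 S2]; [lia|].
    split; [|intro w]; f_equal; auto.
  - destruct (IHtyping2 (S k)) as [L2 S2]; [lia|].
    split; [|intro w]; f_equal; auto.
  - destruct (IHtyping1 k Hk) as [L1 S1], (IHtyping2 k Hk) as [L2 S2].
    split; [|intro w]; f_equal; auto.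
Qed.

Corollary is_type_closed T : is_type [] T -> closed T.
Proof. intros [n H] k. apply (typing_closed _ _ _ H). simpl. lia. Qed.

Lemma typing_from_nil Γ t T : typing [] t T -> closed t -> closed T -> typing Γ t T.
Proof.
  intros H Ht HT. induction Γ as [|A Γ IH]; [exact H|].
  rewrite <- (proj1 (Ht 0)), <- (proj1 (HT 0)). apply weakening, IH.
Qed.

Lemma is_type_from_nil Γ T : is_type [] T -> is_type Γ T.
Proof.
  intro H. pose proof (is_type_closed T H) as HT. destruct H as [n H].
  exists n. apply (typing_from_nil _ _ _ H HT). intro k. split; reflexivity.
Qed.

Lemma expand_cst_type ds c : expand ds (close (cst_type c)) = close (cst_type c).
Proof. destruct c; reflexivity. Qed.

(** * A type checker *)

Fixpoint spine (t : tm) (us : list tm) : tm * list tm :=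
  match t with
  | App t u => spine t (u :: us)
  | _ => (t, us)
  end.

Lemma spine_apps t : forall us h vs, spine t us = (h, vs) -> apps t us = apps h vs.
Proof.
  induction t; simpl; intros us h vs H; try (injection H as <- <-; reflexivity).
  apply IHt1 in H. exact H.
Qed.

Lemma apps_app t us vs : apps t (us ++ vs) = apps (apps t us) vs.
Proof. apply fold_left_app. Qed.

Fixpoint all2 (p : tm -> tm -> bool) (ts us : list tm) : bool :=
  match ts, us with
  | [], [] => true
  | t :: ts, u :: us => p t u &&& all2 p ts us
  | _, _ => false
  end.

(** A defining equation asks that several arguments be identical, while those of
    a term at hand are only convertible; hence the parameter [cv]. *)
Definition reduct (whd : tm -> tm) (cv : tm -> tm -> bool) (c : cst)
  (us : list tm) : option (tm * list tm) :=
  match c, us with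
  | cSigInd n m, A :: B :: D :: d :: p :: r =>
      match spine (whd p) [] with
      | (Cst (cPair n'), [A'; B'; a; b]) =>
          if (n' =? n) &&& cv A' A &&& cv B' B then Some (d, a :: b :: r) else None
      | _ => None
      end
  | cSumInd n m, A :: B :: D :: d :: d' :: p :: r =>
      match spine (whd p) [] with
      | (Cst (cInl n'), [A'; B'; a]) =>
          if (n' =? n) &&& cv A' A &&& cv B' B then Some (d, a :: r) else None
      | (Cst (cInr n'), [A'; B'; b]) =>
          if (n' =? n) &&& cv A' A &&& cv B' B then Some (d', b :: r) else None
      | _ => None
      end
  | cJ n m, A :: a :: D :: d :: b :: p :: r =>
      match spine (whd p) [] with
      | (Cst (cRefl n'), [A'; a']) =>
          if (n' =? n) &&& cv A' A &&& cv a' a &&& cv b a then Some (d, r) else None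
      | _ => None
      end
  | cPOind n m, L :: M :: N :: f :: g :: D :: dl :: dr :: dg :: p :: r =>
      match spine (whd p) [] with
      | (Cst (cPOinl n'), [L'; M'; N'; f'; g'; a]) =>
          if (n' =? n) &&& cv L' L &&& cv M' M &&& cv N' N &&& cv f' f &&& cv g' g
          then Some (dl, a :: r) else None
      | (Cst (cPOinr n'), [L'; M'; N'; f'; g'; b]) =>
          if (n' =? n) &&& cv L' L &&& cv M' M &&& cv N' N &&& cv f' f &&& cv g' g
          then Some (dr, b :: r) else None
      | _ => None
      end
  | cCind n m, L :: M :: N :: f :: g :: x
      :: D :: dnil :: dgl :: dlinv :: dleq :: drinv :: dreq :: y :: p :: r =>
      let vf l := apps (Cst (cInl n)) [M; N; App f l] in
      let vg l := apps (Cst (cInr n)) [M; N; App g l] in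
      let ind y c := apps (Cst (cCind n m))
        [L; M; N; f; g; x; D; dnil; dgl; dlinv; dleq; drinv; dreq; y; c] in
      match spine (whd p) [] with
      | (Cst (cNil n'), [L'; M'; N'; f'; g'; x']) =>
          if (n' =? n) &&& cv L' L &&& cv M' M &&& cv N' N &&& cv f' f &&& cv g' g
             &&& cv x' x &&& cv y x
          then Some (dnil, r) else None
      | (Cst (cGl n'), [L'; M'; N'; f'; g'; x'; l; z]) =>
          if (n' =? n) &&& cv L' L &&& cv M' M &&& cv N' N &&& cv f' f &&& cv g' g
             &&& cv x' x &&& cv y (vg l)
          then Some (dgl, l :: z :: ind (vf l) z :: r) else None
      | (Cst (cLinv n'), [L'; M'; N'; f'; g'; x'; l; w]) =>
          if (n' =? n) &&& cv L' L &&& cv M' M &&& cv N' N &&& cv f' f &&& cv g' g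
             &&& cv x' x &&& cv y (vf l)
          then Some (dlinv, l :: w :: ind (vg l) w :: r) else None
      | (Cst (cRinv n'), [L'; M'; N'; f'; g'; x'; l; w]) =>
          if (n' =? n) &&& cv L' L &&& cv M' M &&& cv N' N &&& cv f' f &&& cv g' g
             &&& cv x' x &&& cv y (vf l)
          then Some (drinv, l :: w :: ind (vg l) w :: r) else None
      | _ => None
      end
  | _, _ => None
  end.

(** The reduct of a type is checked again, and [infer] does not succeed on every
    redex; contracting the redexes makes it succeed. *)
Fixpoint beta (k : nat) (t : tm) : tm :=
  match k with
  | 0 => t
  | S k =>
      match t with
      | App t u =>
          match beta k t with
          | Lam b => beta k (subst 0 u b)
          | t' => App t' (beta k u)
          end
      | Pi A B => Pi (beta k A) (beta k B)
      | Lam b => Lam (beta k b)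
      | _ => t
      end
  end.

Fixpoint get (Γ : list tm) (i : nat) : option tm :=
  match Γ, i with
  | [], _ => None
  | A :: _, 0 => Some (lift 0 A)
  | _ :: Γ, S i => option_map (lift 0) (get Γ i)
  end.

Lemma get_lookup Γ : forall i A, get Γ i = Some A -> lookup Γ i A.
Proof.
  induction Γ as [|B Γ IH]; intros i A H; [discriminate|].
  destruct i; simpl in H.
  - injection H as <-. constructor.
  - destruct (get Γ i) eqn:E; simpl in H; [|discriminate].
    injection H as <-. constructor. auto.
Qed.

Fixpoint starts_with_lam (t : tm) : bool :=
  match t with
  | Lam _ => true
  | App t _ => starts_with_lam t
  | _ => false
  end.

Section checker.
  Variables (known : list cst) (env : list entry) (ds : list tm).

  Definition body (c : cst) : option tm :=
    match named c with
    | Some i =>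
        match nth_error env i with
        | Some e => if transparent e then Some (ebody e) else None
        | None => None
        end
    | None => None
    end.

  Definition type_of (c : cst) : option tm :=
    match named c with
    | Some i => option_map etype (nth_error env i)
    | None => if existsb (cst_eqb c) known then Some (close (cst_type c)) else None
    end.

  (** Tried before unfolding: two instances of a definition mostly agree because
      their arguments do. *)
  Definition same_name (cv : tm -> tm -> bool) (t u : tm) : bool :=
    match spine t [], spine u [] with
    | (Cst c, ts), (Cst d, us) =>
        match body c with
        | Some _ => cst_eqb c d &&& all2 cv ts us
        | None => false
        end
    | _, _ => false
    end.

  Fixpoint whnf (k : nat) (t : tm) (us : list tm) : tm :=
    match k with
    | 0 => apps t us
    | S k =>
        match t, us with
        | App t u, _ => whnf k t (u :: us)
        | Lam b, u :: us => whnf k (subst 0 u b) us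
        | Cst c, _ =>
            match body c with
            | Some b => whnf k b us
            | None =>
                match reduct (fun t => whnf k t []) (convb k) c us with
                | Some (t', us') => whnf k t' us'
                | None => apps t us
                end
            end
        | _, _ => apps t us
        end
    end
  with convb (k : nat) (t u : tm) : bool :=
    match k with
    | 0 => false
    | S k =>
        tm_eqb t u ||| same_name (convb k) t u |||
        match whnf k t [], whnf k u [] with
        | Pi A B, Pi A' B' => convb k A A' &&& convb k B B'
        | Lam b, Lam b' => convb k b b'
        | Lam b, u => convb k b (App (lift 0 u) (Var 0))
        | t, Lam b => convb k (App (lift 0 t) (Var 0)) b
        | App t1 t2, App u1 u2 => convb k t1 u1 &&& convb k t2 u2
        | t, u => tm_eqb t u
        end
    end.

  (** The first argument of all these functions bounds the depth of the recursion.
      Abstractions carry no type; [hints] are the types of the arguments to which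
      [t] is applied, from which the type of an abstraction at the head of a
      redex is found. *)
  Fixpoint infer (k : nat) (Γ hints : list tm) (t : tm) : option tm :=
    match k with
    | 0 => None
    | S k =>
        match t with
        | Var i => get Γ i
        | Univ n => Some (Univ (S n))
        | Cst c => type_of c
        | Pi A B =>
            match sort k Γ A, sort k (A :: Γ) B with
            | Some i, Some j => Some (Univ (Nat.max i j))
            | _, _ => None
            end
        | Lam b =>
            match hints with
            | A :: hints =>
                option_map (Pi A) (infer k (A :: Γ) (map (lift 0) hints) b)
            | [] => None
            end
        | App t u =>
            if starts_with_lam t then
              match infer k Γ [] u with
              | Some A =>
                  match infer k Γ (A :: hints) t with
                  | Some (Pi A' B) => if tm_eqb A A' then Some (subst 0 u B) else None
                  | _ => None
                  end
              | None => None
              end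
            else
              match infer k Γ [] t with
              | Some T =>
                  match as_pi k Γ T with
                  | Some (A, B) => if check k Γ u A then Some (subst 0 u B) else None
                  | None => None
                  end
              | None => None
              end
        end
    end
  with sort (k : nat) (Γ : list tm) (A : tm) : option nat :=
    match k with
    | 0 => None
    | S k =>
        match infer k Γ [] A with
        | Some T => match whnf k T [] with Univ i => Some i | _ => None end
        | None => None
        end
    end
  with as_pi (k : nat) (Γ : list tm) (T : tm) : option (tm * tm) :=
    match k with
    | 0 => None
    | S k =>
        match T with
        | Pi A B => Some (A, B)
        | _ =>
            match beta k (whnf k T []) with
            | Pi A B =>
                match sort k Γ (Pi A B) with Some _ => Some (A, B) | None => None end
            | _ => None
            end
        end
    end
  with check (k : nat) (Γ : list tm) (t T : tm) : bool :=
    match k with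
    | 0 => false
    | S k =>
        match t with
        | Lam b =>
            match as_pi k Γ T with
            | Some (A, B) => check k (A :: Γ) b B
            | None => false
            end
        | _ =>
            match infer k Γ [] t with
            | Some T' =>
                convb k T' T |||
                match whnf k T' [], whnf k T [] with
                | Univ i, Univ j => i <=? j
                | _, _ => false
                end
            | None => false
            end
        end
    end.

  (** ** Soundness *)

  Notation "⟦ t ⟧" := (expand ds t) (at level 0, t at level 99).

  Record realizes : Prop := {
    known_types : forall c, In c known -> is_type [] (close (cst_type c));
    definitions_closed : Forall closed ds;
    entries_hold : forall i e, nth_error env i = Some e ->
      nth_error ds i = Some ⟦ebody e⟧ /\
      typing [] ⟦ebody e⟧ ⟦etype e⟧ /\ is_type [] ⟦etype e⟧ }.
  Hypothesis Hreal : realizes.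

  Lemma expand_name_closed c i : named c = Some i -> closed ⟦Cst c⟧.
  Proof.
    intro Hc. simpl. rewrite Hc. destruct (nth_in_or_default i ds (Cst c)) as [H|H].
    - exact (proj1 (Forall_forall _ _) (definitions_closed Hreal) _ H).
    - rewrite H. split; reflexivity.
  Qed.

  Lemma expand_lift t : forall k, ⟦lift k t⟧ = lift k ⟦t⟧.
  Proof.
    induction t; intro k; try (simpl; f_equal; auto; fail).
    change (lift k (Cst c)) with (Cst c). destruct (named c) eqn:E.
    - symmetry. apply (expand_name_closed c n E).
    - simpl. rewrite E. reflexivity.
  Qed.

  Lemma expand_subst t : forall k u, ⟦subst k u t⟧ = subst k ⟦u⟧ ⟦t⟧.
  Proof.
    induction t; intros k u; try (simpl; rewrite <- ?expand_lift; f_equal; auto; fail).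
    - simpl. destruct (Nat.compare i k); reflexivity.
    - change (subst k u (Cst c)) with (Cst c). destruct (named c) eqn:E.
      + symmetry. apply (expand_name_closed c n E).
      + simpl. rewrite E. reflexivity.
  Qed.

  (** The judgments about terms that contain names are those about the expanded
      terms, and they satisfy the same rules. *)
  Definition convd (t u : tm) : Prop := conv ⟦t⟧ ⟦u⟧.
  Definition typingd (Γ : list tm) (t T : tm) : Prop := typing (map (expand ds) Γ) ⟦t⟧ ⟦T⟧.
  Definition is_typed (Γ : list tm) (T : tm) : Prop := is_type (map (expand ds) Γ) ⟦T⟧.
  Definition wfd (Γ : list tm) : Prop := wf (map (expand ds) Γ).

  Lemma convd_refl t : convd t t.
  Proof. apply conv_refl. Qed.
  Lemma convd_sym t u : convd t u -> convd u t.
  Proof. apply conv_sym. Qed.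
  Lemma convd_trans t u v : convd t u -> convd u v -> convd t v.
  Proof. apply conv_trans. Qed.
  Lemma convd_pi A A' B B' : convd A A' -> convd B B' -> convd (Pi A B) (Pi A' B').
  Proof. apply conv_pi. Qed.
  Lemma convd_lam b b' : convd b b' -> convd (Lam b) (Lam b').
  Proof. apply conv_lam. Qed.
  Lemma convd_app t t' u u' : convd t t' -> convd u u' -> convd (App t u) (App t' u').
  Proof. apply conv_app. Qed.
  Lemma convd_beta b u : convd (App (Lam b) u) (subst 0 u b).
  Proof. unfold convd. rewrite expand_subst. apply conv_beta. Qed.
  Lemma convd_eta t : convd (Lam (App (lift 0 t) (Var 0))) t.
  Proof. unfold convd. simpl. rewrite expand_lift. apply conv_eta. Qed.
  Lemma convd_comp t u : computes t u -> convd t u.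
  Proof. intro H. apply conv_comp. destruct H; simpl; constructor. Qed.
  Lemma convd_body c b : body c = Some b -> convd (Cst c) b.
  Proof.
    unfold body, convd. intro H. destruct (named c) as [i|] eqn:E; [|discriminate].
    destruct (nth_error env i) as [e|] eqn:He; [|discriminate].
    destruct (transparent e); [|discriminate]. injection H as <-.
    apply (entries_hold Hreal) in He as [He _].
    simpl. rewrite E, (nth_error_nth _ _ _ He). apply conv_refl.
  Qed.

  Lemma convd_apps us us' : Forall2 convd us us' -> forall t t', convd t t' ->
    convd (apps t us) (apps t' us').
  Proof. induction 1; simpl; auto using convd_app. Qed.

  Section reduct_sound.
    Variables (whd : tm -> tm) (cv : tm -> tm -> bool).
    Hypothesis whd_sound : forall t, convd t (whd t).
    Hypothesis cv_sound : forall t u, cv t u = true -> convd t u.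

    Lemma conv_spine t h us : spine (whd t) [] = (h, us) -> convd t (apps h us).
    Proof. intro H. rewrite <- (spine_apps _ _ _ _ H). apply whd_sound. Qed.

    Lemma conv_redex us us' t v vs r : Forall2 convd us us' ->
      computes (apps t us') (apps v vs) -> convd (apps t (us ++ r)) (apps v (vs ++ r)).
    Proof.
      intros Hus Hc. rewrite !apps_app. apply convd_apps.
      - induction r; constructor; auto using convd_refl.
      - eapply convd_trans; [|apply convd_comp, Hc].
        apply convd_apps; [exact Hus|apply convd_refl].
    Qed.

    (** The known part of a list, so that the arguments in excess of those of the
        eliminator make up the tail [r] of [conv_redex]. *)
    Ltac prefix us k :=
      lazymatch us with
      | ?a :: ?us => prefix us ltac:(fun p => k (a :: p))
      | _ => k (@nil tm)
      end.

    Ltac by_equation H :=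
      lazymatch goal with |- convd (apps ?h ?us) (apps ?v ?vs) =>
        prefix us ltac:(fun p => prefix vs ltac:(fun q =>
          eapply (conv_redex p _ h v q); [|eapply H])) end;
      solve [ repeat apply Forall2_cons; try apply Forall2_nil;
        try apply convd_refl; auto;
        eapply convd_trans; [eassumption|]; apply convd_apps; [|apply convd_refl];
        repeat apply Forall2_cons; auto using Forall2_nil, convd_refl ].

    Lemma reduct_sound c us t vs : reduct whd cv c us = Some (t, vs) ->
      convd (apps (Cst c) us) (apps t vs).
    Proof.
      unfold reduct. intro H.
      repeat match goal with
      | H : match ?x with _ => _ end = Some _ |- _ =>
          first [ is_var x; destruct x
                | let E := fresh "E" in destruct x eqn:E ]; try discriminate H
      end; bools; injection H as <- <-;
      match goal with E : spine _ _ = _ |- _ => apply conv_spine in E end.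
      all: first
        [ by_equation comp_sig | by_equation comp_inl | by_equation comp_inr
        | by_equation comp_J | by_equation comp_po_inl | by_equation comp_po_inr
        | by_equation comp_nil | by_equation comp_gl | by_equation comp_linv
        | by_equation comp_rinv ].
    Qed.
  End reduct_sound.

  Lemma all2_sound cv ts : (forall t u, cv t u = true -> convd t u) ->
    forall us, all2 cv ts us = true -> Forall2 convd ts us.
  Proof.
    intros Hcv. induction ts as [|t ts IH]; intros [|u us] H; try discriminate H;
      constructor; simpl in H; bools; auto.
  Qed.

  Lemma same_name_sound cv : (forall t u, cv t u = true -> convd t u) ->
    forall t u, same_name cv t u = true -> convd t u.
  Proof.
    unfold same_name. intros Hcv t u H.
    destruct (spine t []) as [h ts] eqn:Et, (spine u []) as [h' us] eqn:Eu.
    destruct h as [| | | | |c]; try discriminate.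
    destruct h' as [| | | | |d]; try discriminate.
    destruct (body c); [|discriminate]. bools.
    apply spine_apps in Et, Eu. simpl in Et, Eu. subst.
    apply convd_apps; [|apply convd_refl]. apply (all2_sound cv); assumption.
  Qed.

  Lemma whnf_convb_sound k :
    (forall t us, convd (apps t us) (whnf k t us)) /\
    (forall t u, convb k t u = true -> convd t u).
  Proof.
    induction k as [|k [IHw IHc]]; split; simpl; try discriminate.
    - intros. apply convd_refl.
    - intros t us. destruct t; try apply convd_refl.
      + destruct us as [|u us]; [apply convd_refl|].
        eapply convd_trans; [|apply IHw]. simpl.
        apply convd_apps; [|apply convd_beta].
        induction us; constructor; auto using convd_refl.
      + apply (IHw t1 (t2 :: us)).
      + destruct (body c) as [b|] eqn:Eb.
        { eapply convd_trans; [|apply IHw]. apply convd_apps; [|apply convd_body, Eb].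
          induction us; constructor; auto using convd_refl. }
        destruct (reduct _ _ _ _) as [[t vs]|] eqn:E; [|apply convd_refl].
        eapply convd_trans; [|apply IHw].
        eapply reduct_sound; [| |exact E]; [exact (fun t => IHw t [])|exact IHc].
    - intros t u H. apply or_else in H. destruct H as [H|H].
      { apply or_else in H as [H|H].
        - rewrite (tm_eqb_eq _ _ H). apply convd_refl.
        - exact (same_name_sound _ IHc _ _ H). }
      eapply convd_trans; [exact (IHw t [])|].
      eapply convd_trans; [|apply convd_sym; exact (IHw u [])].
      destruct (whnf k t []), (whnf k u []);
        try discriminate H; cbn [tm_eqb] in H; bools;
        first
          [ apply convd_refl
          | apply convd_pi; apply IHc; assumption
          | apply convd_app; apply IHc; assumption
          | apply convd_lam, IHc, H
          | apply IHc in H; eapply convd_trans; [apply convd_lam, H|];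
            match goal with |- convd _ ?u => exact (convd_eta u) end
          | apply IHc in H; eapply convd_trans; [|apply convd_lam, H];
            match goal with |- convd ?t _ => exact (convd_sym _ _ (convd_eta t)) end ].
  Qed.

  Definition whnf_sound k t us := proj1 (whnf_convb_sound k) t us.
  Definition convb_sound k t u := proj2 (whnf_convb_sound k) t u.

  Lemma beta_sound k : forall t, convd t (beta k t).
  Proof.
    induction k as [|k IH]; intros t; [apply convd_refl|].
    destruct t as [| |A B|b|t u|]; simpl;
      try solve [apply convd_refl | apply convd_pi; apply IH | apply convd_lam, IH].
    specialize (IH t) as Ht.
    destruct (beta k t); try (apply convd_app; [exact Ht|apply IH]).
    eapply convd_trans; [apply convd_app; [exact Ht|apply convd_refl]|].
    eapply convd_trans; [apply convd_beta|apply IH].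
  Qed.

  Lemma typingd_conv Γ t A B : typingd Γ t A -> is_typed Γ B -> convd A B -> typingd Γ t B.
  Proof. apply typing_conv. Qed.
  Lemma typingd_cumul Γ A i j : i <= j -> typingd Γ A (Univ i) -> typingd Γ A (Univ j).
  Proof. apply typing_cumul. Qed.
  Lemma is_typed_univ Γ i : is_typed Γ (Univ i).
  Proof. exists (S i). apply ty_univ. Qed.
  Lemma is_typed_pi Γ A B : is_typed Γ A -> is_typed (A :: Γ) B -> is_typed Γ (Pi A B).
  Proof. apply is_type_pi. Qed.
  Lemma is_typed_pi_inv Γ A B : is_typed Γ (Pi A B) -> is_typed Γ A /\ is_typed (A :: Γ) B.
  Proof. apply is_type_pi_inv. Qed.
  Lemma is_typed_weakening Γ A B : is_typed Γ A -> is_typed (B :: Γ) (lift 0 A).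
  Proof. unfold is_typed. rewrite expand_lift. apply is_type_weakening. Qed.
  Lemma is_typed_subst Γ A B u : typingd Γ u A -> is_typed (A :: Γ) B ->
    is_typed Γ (subst 0 u B).
  Proof. unfold is_typed. rewrite expand_subst. apply is_type_subst. Qed.
  Lemma wfd_cons Γ A : wfd Γ -> is_typed Γ A -> wfd (A :: Γ).
  Proof. apply wf_cons. Qed.
  Lemma typingd_lam Γ A B b : is_typed Γ A -> typingd (A :: Γ) b B -> typingd Γ (Lam b) (Pi A B).
  Proof. intros [n HA] Hb. exact (ty_lam _ _ _ _ _ HA Hb). Qed.
  Lemma typingd_app Γ A B t u : typingd Γ t (Pi A B) -> typingd Γ u A ->
    typingd Γ (App t u) (subst 0 u B).
  Proof. unfold typingd. rewrite expand_subst. apply ty_app. Qed.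

  Definition inferred Γ t T := typingd Γ t T /\ is_typed Γ T.

  Lemma inferred_var Γ i A : wfd Γ -> lookup Γ i A -> inferred Γ (Var i) A.
  Proof.
    intros Hwf H. assert (H' : lookup (map (expand ds) Γ) i ⟦A⟧).
    { clear Hwf. induction H; simpl; rewrite expand_lift; constructor; assumption. }
    split; [apply ty_var, H'|exact (is_type_lookup _ _ _ Hwf H')].
  Qed.

  Lemma inferred_cst Γ c T : type_of c = Some T -> inferred Γ (Cst c) T.
  Proof.
    unfold type_of. intro H. destruct (named c) as [i|] eqn:E.
    - destruct (nth_error env i) as [e|] eqn:He; [|discriminate]. injection H as <-.
      apply (entries_hold Hreal) in He as [Hn [He HT]].
      split; [|exact (is_type_from_nil _ _ HT)].
      pose proof (expand_name_closed c i E) as Hc.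
      unfold typingd. simpl in *. rewrite E, (nth_error_nth _ _ _ Hn) in *.
      exact (typing_from_nil _ _ _ He Hc (is_type_closed _ HT)).
    - destruct (existsb _ _) eqn:Ex; [|discriminate]. injection H as <-.
      apply existsb_exists in Ex as [c' [Hin Ex]]. apply cst_eqb_eq in Ex as <-.
      apply (known_types Hreal) in Hin. split.
      + unfold typingd. simpl. rewrite E, expand_cst_type. apply ty_cst.
      + unfold is_typed. rewrite expand_cst_type. exact (is_type_from_nil _ _ Hin).
  Qed.

  Lemma whnf_conv k t u : whnf k t [] = u -> convd t u.
  Proof. intros <-. exact (whnf_sound k t []). Qed.

  (** Besides its type, an inferred term has its type derived to be a type; this
      is what the conversion rule asks for, and what substitution in the
      codomain of a product maintains. *)
  Lemma checker_sound k :
    (forall Γ hints t T, wfd Γ -> Forall (is_typed Γ) hints ->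
       infer k Γ hints t = Some T -> inferred Γ t T) /\
    (forall Γ A i, wfd Γ -> sort k Γ A = Some i -> typingd Γ A (Univ i)) /\
    (forall Γ T A B, wfd Γ -> is_typed Γ T -> as_pi k Γ T = Some (A, B) ->
       convd T (Pi A B) /\ is_typed Γ (Pi A B)) /\
    (forall Γ t T, wfd Γ -> is_typed Γ T -> check k Γ t T = true -> typingd Γ t T).
  Proof.
    induction k as [|k [IHi [IHs [IHp IHc]]]]; [repeat split; discriminate|].
    pose proof is_typed_univ as Hu.
    repeat match goal with |- _ /\ _ => split end.
    - intros Γ hints t T Hwf Hh H. destruct t as [i|n|A B|b|t u|c]; simpl in H.
      + exact (inferred_var _ _ _ Hwf (get_lookup _ _ _ H)).
      + injection H as <-. split; [apply ty_univ|apply Hu].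
      + destruct (sort k Γ A) as [i|] eqn:EA; [|discriminate].
        destruct (sort k (A :: Γ) B) as [j|] eqn:EB; [|discriminate].
        injection H as <-. split; [|apply Hu].
        apply IHs in EA; [|exact Hwf].
        apply IHs in EB; [|apply wfd_cons; [exact Hwf|exists i; exact EA]].
        apply ty_pi;
          [apply (typingd_cumul Γ A i)|apply (typingd_cumul (A :: Γ) B j)];
          (assumption || lia).
      + destruct hints as [|A hints]; [discriminate|].
        inversion Hh as [|? ? HA Hh']; subst.
        destruct (infer _ _ _ b) as [B|] eqn:EB; [|discriminate].
        injection H as <-. apply IHi in EB.
        * destruct EB as [Hb HB]. split; [|exact (is_typed_pi _ _ _ HA HB)].
          exact (typingd_lam _ _ _ _ HA Hb).
        * apply wfd_cons; assumption.
        * apply Forall_map. eapply Forall_impl; [|exact Hh'].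
          intros a Ha. apply is_typed_weakening, Ha.
      + destruct (starts_with_lam t).
        * destruct (infer k Γ [] u) as [A|] eqn:Eu; [|discriminate].
          apply IHi in Eu; [|exact Hwf|constructor]. destruct Eu as [Hu' HA].
          destruct (infer k Γ (A :: hints) t) as [Q|] eqn:Et; [|discriminate].
          destruct Q as [| |A' B| | |]; try discriminate.
          destruct (tm_eqb A A') eqn:EA; [|discriminate].
          apply tm_eqb_eq in EA as <-. injection H as <-.
          apply IHi in Et; [|exact Hwf|constructor; assumption].
          destruct Et as [Ht HP]. apply is_typed_pi_inv in HP as [_ HB].
          split; [exact (typingd_app _ _ _ _ _ Ht Hu')|].
          exact (is_typed_subst _ _ _ _ Hu' HB).
        * destruct (infer k Γ [] t) as [Q|] eqn:Et; [|discriminate].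
          apply IHi in Et; [|exact Hwf|constructor]. destruct Et as [Ht HQ].
          destruct (as_pi k Γ Q) as [[A B]|] eqn:EQ; [|discriminate].
          destruct (IHp _ _ _ _ Hwf HQ EQ) as [Hconv HP].
          destruct (check k Γ u A) eqn:Eu; [|discriminate]. injection H as <-.
          apply is_typed_pi_inv in HP as HAB. destruct HAB as [HA HB].
          apply IHc in Eu; [|exact Hwf|exact HA].
          split; [|exact (is_typed_subst _ _ _ _ Eu HB)].
          exact (typingd_app _ _ _ _ _ (typingd_conv _ _ _ _ Ht HP Hconv) Eu).
      + exact (inferred_cst _ _ _ H).
    - intros Γ A i Hwf H. simpl in H.
      destruct (infer k Γ [] A) as [T|] eqn:E; [|discriminate].
      apply IHi in E; [|exact Hwf|constructor]. destruct E as [HA _].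
      destruct (whnf k T []) eqn:ET; try discriminate. injection H as <-.
      exact (typingd_conv _ _ _ _ HA (Hu _ _) (whnf_conv _ _ _ ET)).
    - intros Γ T A B Hwf HT H. simpl in H.
      assert (Hred : match beta k (whnf k T []) with
          | Pi A B => match sort k Γ (Pi A B) with
                      | Some _ => Some (A, B) | None => None end
          | _ => None
          end = Some (A, B) -> convd T (Pi A B) /\ is_typed Γ (Pi A B)).
      { destruct (beta k (whnf k T [])) eqn:ET; try discriminate.
        destruct (sort k Γ _) as [i|] eqn:ES; [|discriminate].
        intro H'. injection H' as <- <-.
        split; [|exists i; exact (IHs _ _ _ Hwf ES)].
        rewrite <- ET. eapply convd_trans; [|apply beta_sound].
        exact (whnf_conv _ _ _ eq_refl). }
      destruct T; try exact (Hred H).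
      injection H as <- <-. split; [apply convd_refl|exact HT].
    - intros Γ t T Hwf HT H. simpl in H.
      assert (Hinf : match infer k Γ [] t with
          | Some T' => convb k T' T |||
              match whnf k T' [], whnf k T [] with
              | Univ i, Univ j => i <=? j
              | _, _ => false
              end
          | None => false
          end = true -> typingd Γ t T).
      { destruct (infer k Γ [] t) as [T'|] eqn:E; [|discriminate].
        apply IHi in E; [|exact Hwf|constructor]. destruct E as [Ht _].
        intro H'. apply or_else in H' as [H'|H'].
        - exact (typingd_conv _ _ _ _ Ht HT (convb_sound _ _ _ H')).
        - destruct (whnf k T' []) as [|i| | | |] eqn:E'; try discriminate.
          destruct (whnf k T []) as [|j| | | |] eqn:E; try discriminate.
          apply Nat.leb_le in H'.
          apply typingd_conv with (Univ j); [|exact HT|].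
          + apply (typingd_cumul _ _ _ _ H').
            exact (typingd_conv _ _ _ _ Ht (Hu _ _) (whnf_conv _ _ _ E')).
          + apply convd_sym, (whnf_conv _ _ _ E). }
      destruct t; try exact (Hinf H).
      destruct (as_pi k Γ T) as [[A B]|] eqn:E; [|discriminate].
      destruct (IHp _ _ _ _ Hwf HT E) as [Hconv HP].
      apply is_typed_pi_inv in HP as [HA HB].
      apply typingd_conv with (Pi A B); [|exact HT|apply convd_sym, Hconv].
      apply IHc in H; [|apply wfd_cons; assumption|exact HB].
      exact (typingd_lam _ _ _ _ HA H).
  Qed.
End checker.

(** * Checked developments *)

Definition is_some {X} (o : option X) : bool := if o then true else false.

Fixpoint names_below (n : nat) (t : tm) : bool :=
  match t with
  | Pi A B => names_below n A &&& names_below n B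
  | Lam b => names_below n b
  | App t u => names_below n t &&& names_below n u
  | Cst c => match named c with Some i => i <? n | None => true end
  | _ => true
  end.

Lemma expand_extend ds ds' t : names_below (length ds) t = true ->
  expand (ds ++ ds') t = expand ds t.
Proof.
  induction t; simpl; intro H; bools; f_equal; auto.
  destruct (named c); [|reflexivity].
  apply app_nth1, Nat.ltb_lt, H.
Qed.

Lemma names_below_S n t : names_below n t = true -> names_below (S n) t = true.
Proof.
  induction t; simpl; intro H; bools; auto.
  - rewrite IHt1, IHt2; auto.
  - rewrite IHt1, IHt2; auto.
  - destruct (named c); [|reflexivity].
    apply Nat.ltb_lt in H. apply Nat.ltb_lt. lia.
Qed.

Section theories.
  Variables (known : list cst) (fuel : nat).

  Lemma sort_sound env ds A : realizes known env ds ->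
    is_some (sort known env fuel [] A) = true -> is_type [] (expand ds A).
  Proof.
    intros Hr H. destruct (sort known env fuel [] A) as [i|] eqn:Es; [|discriminate].
    exists i. exact (proj1 (proj2 (checker_sound _ _ _ Hr fuel)) [] _ _ wf_nil Es).
  Qed.

  Lemma check_sound env ds t A : realizes known env ds -> is_type [] (expand ds A) ->
    check known env fuel [] t A = true -> typing [] (expand ds t) (expand ds A).
  Proof.
    intros Hr HA H.
    exact (proj2 (proj2 (proj2 (checker_sound _ _ _ Hr fuel))) [] _ _ wf_nil HA H).
  Qed.

  Definition check_entry (env : list entry) (e : entry) : bool :=
    names_below (length env) (etype e) &&& names_below (length env) (ebody e)
    &&& is_some (sort known env fuel [] (etype e))
    &&& check known env fuel [] (ebody e) (etype e).

  (** Names refer to entries of the list, so that expansions do not change when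
      the list grows. *)
  Record theory (env : list entry) (ds : list tm) : Prop := {
    realized : realizes known env ds;
    same_length : length ds = length env;
    scoped : Forall (fun e => names_below (length env) (etype e) = true /\
                              names_below (length env) (ebody e) = true) env }.

  Lemma theory_snoc env ds e : theory env ds -> check_entry env e = true ->
    theory (env ++ [e]) (ds ++ [expand ds (ebody e)]).
  Proof.
    intros [Hr Hl Hs] H. unfold check_entry in H. bools.
    match goal with H : is_some _ = true |- _ => pose proof (sort_sound _ _ _ Hr H) as HT end.
    match goal with H : check _ _ _ _ _ _ = true |- _ =>
      pose proof (check_sound _ _ _ _ Hr HT H) as Ht end.
    assert (Hu : forall t, names_below (length env) t = true ->
      expand (ds ++ [expand ds (ebody e)]) t = expand ds t)
      by (rewrite <- Hl; intros; apply expand_extend; assumption).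
    split; [split|rewrite !length_app, Hl; reflexivity|].
    - exact (known_types _ _ _ Hr).
    - apply Forall_app. split; [exact (definitions_closed _ _ _ Hr)|].
      constructor; [|constructor]. intro k. apply (typing_closed _ _ _ Ht). simpl. lia.
    - intros i e' He. destruct (Nat.lt_ge_cases i (length env)) as [Hi|Hi].
      + rewrite nth_error_app1 in He by exact Hi.
        destruct (proj1 (Forall_forall _ _) Hs e' (nth_error_In _ _ He)) as [HsT Hsb].
        apply (entries_hold _ _ _ Hr) in He as [Hn He].
        rewrite nth_error_app1, !Hu by (rewrite ?Hl; assumption). auto.
      + rewrite nth_error_app2 in He by exact Hi.
        rewrite nth_error_app2, Hl by (rewrite Hl; exact Hi).
        destruct (i - length env) as [|j]; [|destruct j; discriminate].
        injection He as <-. rewrite !Hu by assumption. auto.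
    - rewrite length_app, Nat.add_1_r.
      apply Forall_app. split; [|constructor; [split|constructor]]; auto using names_below_S.
      eapply Forall_impl; [|exact Hs]. intros e' [? ?]. auto using names_below_S.
  Qed.

  Fixpoint check_theory (env es : list entry) : bool :=
    match es with
    | [] => true
    | e :: es => check_entry env e &&& check_theory (env ++ [e]) es
    end.

  Lemma check_theory_sound es : forall env ds, theory env ds ->
    check_theory env es = true -> exists ds', theory (env ++ es) ds'.
  Proof.
    induction es as [|e es IH]; intros env ds Ht H; simpl in H.
    - rewrite app_nil_r. eauto.
    - bools. change (e :: es) with ([e] ++ es). rewrite app_assoc.
      eapply IH; [apply theory_snoc|]; eassumption.
  Qed.
End theories.

(** The list has to be in reverse order of dependency. *)
Fixpoint check_constants (fuel : nat) (cs : list cst) : bool :=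
  match cs with
  | [] => true
  | c :: cs =>
      is_some (sort cs [] fuel [] (close (cst_type c))) &&& check_constants fuel cs
  end.

Lemma theory_nil fuel cs : check_constants fuel cs = true -> theory cs [] [].
Proof.
  intro H. split; [split|reflexivity|constructor].
  - induction cs as [|c cs IH]; simpl in H; [contradiction|]. bools.
    intros d [<-|Hd]; [|auto]. rewrite <- (expand_cst_type []).
    apply (sort_sound cs fuel [] []); [|assumption].
    split; [auto|constructor|]. intros [] e; discriminate.
  - constructor.
  - intros [] e; discriminate.
Qed.

(** The goal contains no names, hence is its own expansion. *)
Definition proves (fuel : nat) (cs : list cst) (es : list entry) (t G : tm) : bool :=
  check_constants fuel cs &&& check_theory cs fuel [] es
  &&& is_some (sort cs es fuel [] G) &&& check cs es fuel [] t G
  &&& names_below 0 G.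

Lemma expand_nil t : expand [] t = t.
Proof.
  induction t; simpl; try congruence. destruct (named c) as [[]|]; reflexivity.
Qed.

Theorem proves_sound fuel cs es t G : proves fuel cs es t G = true ->
  exists t', typing [] t' G.
Proof.
  unfold proves. intro H. bools.
  match goal with H : check_constants _ _ = true |- _ => apply theory_nil in H as Ht end.
  match goal with H : check_theory _ _ _ _ = true |- _ =>
    destruct (check_theory_sound _ _ _ _ _ Ht H) as [ds Hds] end.
  simpl in Hds. destruct Hds as [Hr _ _].
  assert (HG : expand ds G = G).
  { rewrite <- (expand_nil G) at 2. apply (expand_extend [] ds). assumption. }
  exists (expand ds t). rewrite <- HG.
  eapply check_sound; [exact Hr|eapply sort_sound; eassumption|eassumption].
Qed.

(** * Terms of the theory *)

Local Open Scope hott_scope.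

Definition jelim (n m : nat) (A a : expr) (D : expr -> expr -> expr)
  (d b p : expr) : expr :=
  const (cJ n m) ⋅ A ⋅ a ⋅ (λ y, λ q, D y q) ⋅ d ⋅ b ⋅ p.
Definition tr (n m : nat) (A : expr) (D : expr -> expr) (a b p u : expr) : expr :=
  jelim n m A a (fun y _ => D y) u b p.
Definition inverse (n : nat) (A a b p : expr) : expr :=
  jelim n n A a (fun y _ => hid n A y a) (hrefl n A a) b p.

Definition sig_elim (n : nat) (A : expr) (B D : expr -> expr)
  (d : expr -> expr -> expr) (p : expr) : expr :=
  const (cSigInd n n) ⋅ A ⋅ (λ x, B x) ⋅ (λ u, D u) ⋅ (λ a, λ b, d a b) ⋅ p.
Definition hfst (n : nat) (A : expr) (B : expr -> expr) (p : expr) : expr :=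
  sig_elim n A B (fun _ => A) (fun a _ => a) p.
Definition hsnd (n : nat) (A : expr) (B : expr -> expr) (p : expr) : expr :=
  sig_elim n A B (fun u => B (hfst n A B u)) (fun _ b => b) p.

Definition sum_elim (A B : expr) (D dl dr : expr -> expr) (p : expr) : expr :=
  const (cSumInd 0 0) ⋅ A ⋅ B ⋅ (λ u, D u) ⋅ (λ a, dl a) ⋅ (λ b, dr b) ⋅ p.

Definition equiv_map (A B e : expr) : expr :=
  hfst 0 (A ⇒ B) (fun f => is_equiv 0 A B f) e.
Definition mk_equiv (A B f h r k l : expr) : expr :=
  hpair 0 (A ⇒ B) (fun f => is_equiv 0 A B f) f
    (hpair 0 (right_inv 0 A B f) (fun _ => left_inv 0 A B f)
      (hpair 0 (B ⇒ A) (fun h => Π b : B, hid 0 B (f ⋅ (h ⋅ b)) b) h r)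
      (hpair 0 (B ⇒ A) (fun k => Π a : A, hid 0 A (k ⋅ (f ⋅ a)) a) k l)).

Definition definition (T t : expr) : entry := Entry (close T) (close t) true.
Definition lemma (T t : expr) : entry := Entry (close T) (close t) false.

(** Entries refer to one another by their position in [development]. *)
Definition ref (i : nat) : expr := const (name i).

(** * Univalence and function extensionality *)

Definition ua_right_inv (A B : expr) : expr :=
  let I := hid 1 (univ 0) A B in
  let f := λ p, id_to_equiv 0 A B p in
  hfst 1 (right_inv 1 I (equiv 0 A B) f)
    (fun _ => left_inv 1 I (equiv 0 A B) f) (const (cUnivalence 0) ⋅ A ⋅ B).
Definition is_ua (A B h : expr) : expr :=
  Π e : equiv 0 A B, hid 1 (equiv 0 A B) ((λ p, id_to_equiv 0 A B p) ⋅ (h ⋅ e)) e.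
Definition ua (A B e : expr) : expr :=
  hfst 1 (equiv 0 A B ⇒ hid 1 (univ 0) A B) (is_ua A B) (ua_right_inv A B) ⋅ e.
Definition ua_beta (A B e : expr) : expr :=
  hsnd 1 (equiv 0 A B ⇒ hid 1 (univ 0) A B) (is_ua A B) (ua_right_inv A B) ⋅ e.

(** By univalence every equivalence is [id_to_equiv] of a path, and a path can
    be contracted. *)
Definition equiv_induction_entry : entry := lemma
  (Π A : univ 0, Π D : (Π B : univ 0, equiv 0 A B ⇒ univ 0),
   D ⋅ A ⋅ id_equiv 0 A ⇒ Π B : univ 0, Π e : equiv 0 A B, D ⋅ B ⋅ e)
  (λ A, λ D, λ d, λ B, λ e,
    tr 1 0 (equiv 0 A B) (fun e => D ⋅ B ⋅ e) (id_to_equiv 0 A B (ua A B e)) e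
      (ua_beta A B e)
      (jelim 1 0 (univ 0) A (fun B p => D ⋅ B ⋅ id_to_equiv 0 A B p) d B (ua A B e))).
Definition equiv_induction : expr := ref 0.

Definition paths_from (B u : expr) : expr := hsig 0 B (fun v => hid 0 B u v).
Definition path_space (B : expr) : expr := hsig 0 B (fun u => paths_from B u).
Definition path (B u v p : expr) : expr :=
  hpair 0 B (paths_from B) u (hpair 0 B (fun v => hid 0 B u v) v p).
Definition source (B w : expr) : expr := hfst 0 B (paths_from B) w.
Definition target (B w : expr) : expr :=
  hfst 0 B (fun v => hid 0 B (source B w) v) (hsnd 0 B (paths_from B) w).

Definition source_equiv (B : expr) : expr :=
  let W := path_space B in
  let idp u := path B u u (hrefl 0 B u) in
  mk_equiv W B (λ w, source B w)
    (λ u, idp u) (λ u, hrefl 0 B u)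
    (λ u, idp u)
    (λ w, sig_elim 0 B (paths_from B)
       (fun w => hid 0 W (idp (source B w)) w)
       (fun u r => sig_elim 0 B (fun v => hid 0 B u v)
          (fun r => hid 0 W (idp u) (hpair 0 B (paths_from B) u r))
          (fun v p => jelim 0 0 B u (fun v p => hid 0 W (idp u) (path B u v p))
             (hrefl 0 W (idp u)) v p)
          r)
       w).

(** A pointwise path from [f] to [g] is a map [v] into the path space of [B].
    Composition with the equivalence [source] is injective (by equivalence
    induction it may be assumed to be the identity), and it sends both [v] and
    the map [u] of constant paths on [f] to [f]; so [u = v], and composing
    with [target] gives [f = g]. *)
Definition funext_entry : entry := lemma
  (Π A : univ 0, Π B : univ 0, Π f : (A ⇒ B), Π g : (A ⇒ B),
   (Π a : A, hid 0 B (f ⋅ a) (g ⋅ a)) ⇒ hid 0 (A ⇒ B) f g)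
  (λ A, λ B, λ f, λ g, λ H,
    let W := path_space B in
    let u := λ a, path B (f ⋅ a) (f ⋅ a) (hrefl 0 B (f ⋅ a)) in
    let v := λ a, path B (f ⋅ a) (g ⋅ a) (H ⋅ a) in
    let comp Y e u := λ a, equiv_map W Y e ⋅ (u ⋅ a) in
    let injective :=
      equiv_induction ⋅ W
        ⋅ (λ Y, λ e, Π u : (A ⇒ W), Π v : (A ⇒ W),
             hid 0 (A ⇒ Y) (comp Y e u) (comp Y e v) ⇒ hid 0 (A ⇒ W) u v)
        ⋅ (λ u, λ v, λ p, p) in
    tr 0 0 (A ⇒ W) (fun w => hid 0 (A ⇒ B) f (λ a, target B (w ⋅ a))) u v
      (injective ⋅ B ⋅ source_equiv B ⋅ u ⋅ v ⋅ hrefl 0 (A ⇒ B) f)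
      (hrefl 0 (A ⇒ B) f)).
Definition funext : expr := ref 1.

(** * Families over a path *)

(** The map [egl] is transport along [ep] up to a path [eη] between functions,
    not only up to a pointwise path: this is what lets [eη] be contracted
    together with [ep]. *)
Record edge : Set := Edge { eP : expr; eK : expr; ea : expr; eb : expr;
                            ep : expr; egl : expr; eη : expr }.

Definition is_transport (P K a b q gl : expr) : expr :=
  hid 0 (K ⋅ a ⇒ K ⋅ b) (λ z, transport 0 0 P K a b q z) gl.

Definition pi_edge (k : edge -> expr) : expr :=
  Π P : univ 0, Π K : (P ⇒ univ 0), Π a : P, Π b : P, Π q : hid 0 P a b,
  Π gl : (K ⋅ a ⇒ K ⋅ b), Π η : is_transport P K a b q gl,
    k (Edge P K a b q gl η).
Definition lam_edge (k : edge -> expr) : expr :=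
  λ P, λ K, λ a, λ b, λ q, λ gl, λ η, k (Edge P K a b q gl η).
Definition app_edge (t : expr) (e : edge) : expr :=
  t ⋅ eP e ⋅ eK e ⋅ ea e ⋅ eb e ⋅ ep e ⋅ egl e ⋅ eη e.

(** Contracts first [q], on which the type of [η] depends, and then [η]; what
    remains is the identity map over a constant path. *)
Definition edge_elim (e : edge) (T : edge -> expr) (d : expr) : expr :=
  let P := eP e in let K := eK e in let a := ea e in
  jelim 0 0 P a
    (fun b q => Π gl : (K ⋅ a ⇒ K ⋅ b), Π η : is_transport P K a b q gl,
       T (Edge P K a b q gl η))
    (λ gl, λ η, jelim 0 0 (K ⋅ a ⇒ K ⋅ a) (λ z, z)
       (fun gl η => T (Edge P K a a (hrefl 0 P a) gl η)) d gl η)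
    (eb e) (ep e) ⋅ egl e ⋅ eη e.

(** The method at [glue] of a family defined by pushout recursion, for an
    equivalence [e] between its values: a transport in a constant family is
    not the identity by computation, hence the path induction. *)
Definition glue_method (P a b q X Y e : expr) : expr :=
  jelim 0 1 P a
    (fun b q => hid 1 (univ 0) (transport 0 1 P (λ _, univ 0) a b q X) Y)
    (ua X Y e) b q.

Definition descent_type (P K a b q : expr) : expr :=
  Π e : equiv 0 (K ⋅ a) (K ⋅ b),
  hid 1 (hid 1 (univ 0) (transport 0 1 P (λ _, univ 0) a b q (K ⋅ a)) (K ⋅ b))
    (apd 0 1 P (λ _, univ 0) K a b q) (glue_method P a b q (K ⋅ a) (K ⋅ b) e) ⇒
  is_transport P K a b q (equiv_map (K ⋅ a) (K ⋅ b) e).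

(** Over a constant path the hypothesis is a path from the constant path to
    [ua e]; so the identity is the map of [id_to_equiv (ua e)], which is the
    map of [e]. *)
Definition descent_entry : entry := lemma
  (Π P : univ 0, Π K : (P ⇒ univ 0), Π a : P, Π b : P, Π q : hid 0 P a b,
   descent_type P K a b q)
  (λ P, λ K, λ a, λ b, λ q,
    jelim 0 1 P a (descent_type P K a)
      (λ e, λ r,
        let X := K ⋅ a in
        let T g := hid 0 (X ⇒ X) (λ z, z) (equiv_map X X g) in
        tr 1 0 (equiv 0 X X) T (id_to_equiv 0 X X (ua X X e)) e (ua_beta X X e)
          (tr 1 0 (hid 1 (univ 0) X X) (fun p => T (id_to_equiv 0 X X p))
             (hrefl 1 (univ 0) X) (ua X X e) r (hrefl 0 (X ⇒ X) (λ z, z))))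
      b q).
Definition descent : expr := ref 2.

Definition tr_edge (e : edge) (E u : expr) : expr :=
  tr 0 0 (eP e) (fun y => E ⋅ y) (ea e) (eb e) (ep e) u.

Definition commutes (e : edge) (E u v : expr) : expr :=
  Π z : eK e ⋅ ea e, hid 0 (E ⋅ eb e) (tr_edge e E (u ⋅ z)) (v ⋅ (egl e ⋅ z)).

(** For the identity edge this is function extensionality. *)
Definition transport_function_entry : entry := lemma
  (pi_edge (fun e => Π E : (eP e ⇒ univ 0),
   Π u : (eK e ⋅ ea e ⇒ E ⋅ ea e), Π v : (eK e ⋅ eb e ⇒ E ⋅ eb e),
   commutes e E u v ⇒
   hid 0 (eK e ⋅ eb e ⇒ E ⋅ eb e)
     (tr 0 0 (eP e) (fun y => eK e ⋅ y ⇒ E ⋅ y) (ea e) (eb e) (ep e) u) v))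
  (lam_edge (fun e => λ E, λ u, λ v,
   edge_elim e
     (fun e => Π v : (eK e ⋅ eb e ⇒ E ⋅ eb e), commutes e E u v ⇒
        hid 0 (eK e ⋅ eb e ⇒ E ⋅ eb e)
          (tr 0 0 (eP e) (fun y => eK e ⋅ y ⇒ E ⋅ y) (ea e) (eb e) (ep e) u) v)
     (λ v, funext ⋅ (eK e ⋅ ea e) ⋅ (E ⋅ ea e) ⋅ u ⋅ v) ⋅ v)).
Definition transport_function : expr := ref 3.

(** ** Lifting an edge and its inverses to a family over [K] *)

Definition family (e : edge) : expr := Π b : eP e, eK e ⋅ b ⇒ univ 0.

Definition lift_type (e : edge) (D : expr) : expr :=
  Π z : eK e ⋅ ea e, D ⋅ ea e ⋅ z ⇒ D ⋅ eb e ⋅ (egl e ⋅ z).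
(** Transparent, because over the identity edge it has to compute to the
    identity. *)
Definition edge_lift_entry : entry := definition
  (pi_edge (fun e => Π D : family e, lift_type e D))
  (lam_edge (fun e => λ D, edge_elim e (fun e => lift_type e D) (λ z, λ d, d))).
Definition edge_lift (e : edge) (D : expr) : expr := app_edge (ref 4) e ⋅ D.

(** For a map [F] of families; it is used for the projection of a point of a
    homotopy fibre of [encode] to its path. *)
Definition lift_natural (e : edge) (D E F : expr) : expr :=
  Π z : eK e ⋅ ea e, Π d : D ⋅ ea e ⋅ z,
  hid 0 (E ⋅ eb e) (tr_edge e E (F ⋅ ea e ⋅ z ⋅ d))
    (F ⋅ eb e ⋅ (egl e ⋅ z) ⋅ (edge_lift e D ⋅ z ⋅ d)).
Definition edge_lift_natural_entry : entry := lemma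
  (pi_edge (fun e => Π D : family e, Π E : (eP e ⇒ univ 0),
   Π F : (Π b : eP e, Π w : eK e ⋅ b, D ⋅ b ⋅ w ⇒ E ⋅ b), lift_natural e D E F))
  (lam_edge (fun e => λ D, λ E, λ F,
   edge_elim e (fun e => lift_natural e D E F)
     (λ z, λ d, hrefl 0 (E ⋅ ea e) (F ⋅ ea e ⋅ z ⋅ d)))).
Definition edge_lift_natural (e : edge) (D E F : expr) : expr :=
  app_edge (ref 5) e ⋅ D ⋅ E ⋅ F.

Definition inverse_type (e : edge) : expr := eK e ⋅ eb e ⇒ eK e ⋅ ea e.
Definition inverse_lift_type (e : edge) (D h : expr) : expr :=
  Π w : eK e ⋅ eb e, D ⋅ eb e ⋅ w ⇒ D ⋅ ea e ⋅ (h ⋅ w).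

Definition left_lift_over (e : edge) (D h p dh : expr) : expr :=
  Π z : eK e ⋅ ea e, Π d : D ⋅ ea e ⋅ z,
  hid 0 (D ⋅ ea e ⋅ z)
    (transport 0 0 (eK e ⋅ ea e) (D ⋅ ea e) (h ⋅ (egl e ⋅ z)) z (p ⋅ z)
       (dh ⋅ (egl e ⋅ z) ⋅ (edge_lift e D ⋅ z ⋅ d)))
    d.
Definition right_lift_over (e : edge) (D h p dh : expr) : expr :=
  Π w : eK e ⋅ eb e, Π d : D ⋅ eb e ⋅ w,
  hid 0 (D ⋅ eb e ⋅ w)
    (transport 0 0 (eK e ⋅ eb e) (D ⋅ eb e) (egl e ⋅ (h ⋅ w)) w (p ⋅ w)
       (edge_lift e D ⋅ (h ⋅ w) ⋅ (dh ⋅ w ⋅ d)))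
    d.

Definition left_lift_type (e : edge) (D : expr) : expr :=
  Π h : inverse_type e,
  Π p : (Π z : eK e ⋅ ea e, hid 0 (eK e ⋅ ea e) (h ⋅ (egl e ⋅ z)) z),
  hsig 0 (inverse_lift_type e D h) (left_lift_over e D h p).
Definition right_lift_type (e : edge) (D : expr) : expr :=
  Π h : inverse_type e,
  Π p : (Π w : eK e ⋅ eb e, hid 0 (eK e ⋅ eb e) (egl e ⋅ (h ⋅ w)) w),
  hsig 0 (inverse_lift_type e D h) (right_lift_over e D h p).

(** An inverse [h] of the identity of [X], with paths [p z] from [h z] to [z],
    lifts to transport against [p]; the second component says that transport
    along [p] undoes it. *)
Definition identity_inverse_lift (X D h p : expr) : expr :=
  let back y z r := tr 0 0 X (fun z => D ⋅ z) z y (inverse 0 X y z r) in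
  let cancel y z r := Π d : D ⋅ z,
    hid 0 (D ⋅ z) (transport 0 0 X D y z r (back y z r d)) d in
  hpair 0 (Π z : X, D ⋅ z ⇒ D ⋅ (h ⋅ z))
    (fun dh => Π z : X, Π d : D ⋅ z,
       hid 0 (D ⋅ z) (transport 0 0 X D (h ⋅ z) z (p ⋅ z) (dh ⋅ z ⋅ d)) d)
    (λ z, λ d, back (h ⋅ z) z (p ⋅ z) d)
    (λ z, jelim 0 0 X (h ⋅ z) (cancel (h ⋅ z))
       (λ d, hrefl 0 (D ⋅ (h ⋅ z)) d) z (p ⋅ z)).

Definition edge_left_lift_entry : entry := lemma
  (pi_edge (fun e => Π D : family e, left_lift_type e D))
  (lam_edge (fun e => λ D, edge_elim e (fun e => left_lift_type e D)
     (λ h, λ p, identity_inverse_lift (eK e ⋅ ea e) (D ⋅ ea e) h p))).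
Definition edge_left_lift (e : edge) (D h p : expr) : expr :=
  app_edge (ref 6) e ⋅ D ⋅ h ⋅ p.
Definition edge_right_lift_entry : entry := lemma
  (pi_edge (fun e => Π D : family e, right_lift_type e D))
  (lam_edge (fun e => λ D, edge_elim e (fun e => right_lift_type e D)
     (λ h, λ p, identity_inverse_lift (eK e ⋅ ea e) (D ⋅ ea e) h p))).
Definition edge_right_lift (e : edge) (D h p : expr) : expr :=
  app_edge (ref 7) e ⋅ D ⋅ h ⋅ p.

(** * The family of codes *)

Definition pi_based (k : span -> expr -> expr) : expr :=
  pi_span 0 (fun s => Π x : vertices 0 s, k s x).
Definition lam_based (k : span -> expr -> expr) : expr :=
  λ L, λ M, λ N, λ f, λ g, λ x, k (Span L M N f g) x.
Definition based (i : nat) (s : span) (x : expr) : expr := app_span (name i) s ⋅ x.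

Section based_span.
  Variables (s : span) (x : expr).

  Definition P : expr := po 0 s.
  Definition base : expr := po_in 0 s x.
  Definition left_vertex (a : expr) : expr := hinl 0 (sM s) (sN s) a.
  Definition right_vertex (b : expr) : expr := hinr 0 (sM s) (sN s) b.
  Definition glue_source (l : expr) : expr := po_inl 0 s (sf s ⋅ l).
  Definition glue_target (l : expr) : expr := po_inr 0 s (sg s ⋅ l).
  Definition gl (l : expr) : expr := λ z, C_gl 0 s x l z.
  Definition linv (l : expr) : expr := λ w, C_linv 0 s x l w.
  Definition leq (l : expr) : expr := λ z, C_leq 0 s x l z.
  Definition rinv (l : expr) : expr := λ w, C_rinv 0 s x l w.
  Definition req (l : expr) : expr := λ w, C_req 0 s x l w.
  Definition gl_equiv (l : expr) : expr :=
    mk_equiv (C 0 s x (vf 0 s l)) (C 0 s x (vg 0 s l)) (gl l)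
      (rinv l) (req l) (linv l) (leq l).

  Definition code_methods : po_methods :=
    POMethods (λ _, univ 0)
      (λ a, C 0 s x (left_vertex a)) (λ b, C 0 s x (right_vertex b))
      (λ l, glue_method P (glue_source l) (glue_target l) (po_glue 0 s l)
              (C 0 s x (vf 0 s l)) (C 0 s x (vg 0 s l)) (gl_equiv l)).
  Definition code : expr := based 8 s x.

  Definition code_glue : expr := based 9 s x.
  Definition code_edge (l : expr) : edge :=
    Edge P code (glue_source l) (glue_target l) (po_glue 0 s l) (gl l)
      (code_glue ⋅ l).

  (** [C x y] and the code of [in y] are convertible only when [y] is a
      constructor; for a variable [y] the cast is needed. *)
  Definition to_code (y z : expr) : expr := based 10 s x ⋅ y ⋅ z.
  Definition nil_code : expr := to_code x (C_nil 0 s x).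

  (** ** Encoding and decoding *)

  Definition paths : expr := λ b, hid 0 P base b.
  Definition encode (b p : expr) : expr := transport 0 0 P code base b p nil_code.
  Definition encodes_to (b w p : expr) : expr := hid 0 (code ⋅ b) (encode b p) w.

  Definition preimage : expr := based 11 s x.
  Definition preimage_path : expr := based 12 s x.

  Definition linv_lift (l : expr) : expr :=
    edge_left_lift (code_edge l) preimage (linv l) (leq l).
  Definition rinv_lift (l : expr) : expr :=
    edge_right_lift (code_edge l) preimage (rinv l) (req l).

  (** The induction on [C] that inverts [encode].  The methods at [linv],
      [leq], [rinv] and [req] are the lifts of the inverses of an edge. *)
  Definition preimage_methods : C_methods :=
    CMethods (λ y, λ z, preimage ⋅ po_in 0 s y ⋅ to_code y z)
      (hpair 0 (hid 0 P base base) (encodes_to base nil_code) (hrefl 0 P base)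
         (hrefl 0 (code ⋅ base) nil_code))
      (λ l, edge_lift (code_edge l) preimage)
      (λ l, hfst 0 (inverse_lift_type (code_edge l) preimage (linv l))
         (left_lift_over (code_edge l) preimage (linv l) (leq l)) (linv_lift l))
      (λ l, hsnd 0 (inverse_lift_type (code_edge l) preimage (linv l))
         (left_lift_over (code_edge l) preimage (linv l) (leq l)) (linv_lift l))
      (λ l, hfst 0 (inverse_lift_type (code_edge l) preimage (rinv l))
         (right_lift_over (code_edge l) preimage (rinv l) (req l)) (rinv_lift l))
      (λ l, hsnd 0 (inverse_lift_type (code_edge l) preimage (rinv l))
         (right_lift_over (code_edge l) preimage (rinv l) (req l)) (rinv_lift l)).
  Definition find_preimage (y z : expr) : expr := based 13 s x ⋅ y ⋅ z.
  Definition path_to (y z : expr) : expr :=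
    preimage_path ⋅ po_in 0 s y ⋅ to_code y z ⋅ find_preimage y z.
  Definition encode_path_to (y z : expr) : expr :=
    hsnd 0 (hid 0 P base (po_in 0 s y)) (encodes_to (po_in 0 s y) (to_code y z))
      (find_preimage y z).

  (** The left inverse has to be defined at every point of the pushout, so
      that path induction applies to it; [path_to] gives it at the vertices,
      and its paths commute with [glue] because lifting does. *)
  Definition decode_methods : po_methods :=
    POMethods (λ b, code ⋅ b ⇒ hid 0 P base b)
      (λ a, λ z, path_to (left_vertex a) z) (λ b, λ z, path_to (right_vertex b) z)
      (λ l, app_edge transport_function (code_edge l) ⋅ paths
         ⋅ (λ z, path_to (vf 0 s l) z) ⋅ (λ z, path_to (vg 0 s l) z)
         ⋅ (λ z, edge_lift_natural (code_edge l) preimage paths preimage_path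
                   ⋅ z ⋅ find_preimage (vf 0 s l) z)).
  Definition decode (b : expr) : expr := based 14 s x ⋅ b.
  Definition decodes (y z : expr) : expr :=
    hid 0 (hid 0 P base (po_in 0 s y))
      (decode (po_in 0 s y) ⋅ to_code y z) (path_to y z).
  Definition decode_code : expr := based 15 s x.
  Definition decode_encode : expr := based 16 s x.

  Definition path_equiv (y : expr) : expr :=
    mk_equiv (hid 0 P base (po_in 0 s y)) (C 0 s x y)
      (λ p, encode (po_in 0 s y) p)
      (λ z, path_to y z) (λ z, encode_path_to y z)
      (λ z, decode (po_in 0 s y) ⋅ z) (λ p, decode_encode ⋅ po_in 0 s y ⋅ p).
End based_span.

(** * The development *)

Definition code_entry : entry := definition
  (pi_based (fun s x => P s ⇒ univ 0))
  (lam_based (fun s x => λ p, po_ind 0 1 s (code_methods s x) p)).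

Definition code_glue_entry : entry := lemma
  (pi_based (fun s x => Π l : sL s,
   is_transport (P s) (code s x) (glue_source s l) (glue_target s l)
     (po_glue 0 s l) (gl s x l)))
  (lam_based (fun s x => λ l,
   descent ⋅ P s ⋅ code s x ⋅ glue_source s l ⋅ glue_target s l ⋅ po_glue 0 s l
     ⋅ gl_equiv s x l
     ⋅ (let e := code_methods s x in
        app_span (cPOindGlue 0 1) s ⋅ pD e ⋅ pinl e ⋅ pinr e ⋅ pglue e ⋅ l))).

Definition to_code_entry : entry := definition
  (pi_based (fun s x => Π y : vertices 0 s, C 0 s x y ⇒ code s x ⋅ po_in 0 s y))
  (lam_based (fun s x => λ y,
   sum_elim (sM s) (sN s) (fun y => C 0 s x y ⇒ code s x ⋅ po_in 0 s y)
     (fun _ => λ z, z) (fun _ => λ z, z) y)).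

(** The homotopy fibre of [encode b] over [w]. *)
Definition preimage_entry : entry := definition
  (pi_based (fun s x => Π b : P s, code s x ⋅ b ⇒ univ 0))
  (lam_based (fun s x => λ b, λ w,
   hsig 0 (hid 0 (P s) (base s x) b) (encodes_to s x b w))).

Definition preimage_path_entry : entry := definition
  (pi_based (fun s x => Π b : P s, Π w : code s x ⋅ b,
   preimage s x ⋅ b ⋅ w ⇒ paths s x ⋅ b))
  (lam_based (fun s x => λ b, λ w, λ d,
   hfst 0 (hid 0 (P s) (base s x) b) (encodes_to s x b w) d)).

Definition find_preimage_entry : entry := definition
  (pi_based (fun s x => Π y : vertices 0 s, Π z : C 0 s x y,
   preimage s x ⋅ po_in 0 s y ⋅ to_code s x y z))
  (lam_based (fun s x => λ y, λ z, C_ind 0 0 s x (preimage_methods s x) y z)).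

Definition decode_entry : entry := definition
  (pi_based (fun s x => Π b : P s, code s x ⋅ b ⇒ hid 0 (P s) (base s x) b))
  (lam_based (fun s x => λ b, po_ind 0 0 s (decode_methods s x) b)).

(** Holds by computation once [y] is a constructor. *)
Definition decode_code_entry : entry := lemma
  (pi_based (fun s x => Π y : vertices 0 s, Π z : C 0 s x y, decodes s x y z))
  (lam_based (fun s x => λ y,
   let r y := λ z, hrefl 0 (hid 0 (P s) (base s x) (po_in 0 s y)) (path_to s x y z) in
   sum_elim (sM s) (sN s) (fun y => Π z : C 0 s x y, decodes s x y z)
     (fun a => r (left_vertex s a)) (fun b => r (right_vertex s b)) y)).

(** By path induction it is enough to decode the code of [nil], and the
    preimage found for [nil] is the constant path. *)
Definition decode_encode_entry : entry :=
  let T s x b p :=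
    hid 0 (hid 0 (P s) (base s x) b) (decode s x b ⋅ encode s x b p) p in
  lemma
  (pi_based (fun s x => Π b : P s, Π p : hid 0 (P s) (base s x) b, T s x b p))
  (lam_based (fun s x => λ b, λ p,
   jelim 0 0 (P s) (base s x) (T s x) (decode_code s x ⋅ x ⋅ C_nil 0 s x) b p)).

Definition main_type : expr :=
  pi_based (fun s x => Π y : vertices 0 s,
    equiv 0 (hid 0 (P s) (base s x) (po_in 0 s y)) (C 0 s x y)).
(** The case analysis on [y] makes [C x y] convertible to the value of [code]. *)
Definition main_term : expr :=
  lam_based (fun s x => λ y,
    sum_elim (sM s) (sN s)
      (fun y => equiv 0 (hid 0 (P s) (base s x) (po_in 0 s y)) (C 0 s x y))
      (fun a => path_equiv s x (left_vertex s a))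
      (fun b => path_equiv s x (right_vertex s b)) y).

Definition development : list entry :=
  [ equiv_induction_entry; funext_entry; descent_entry; transport_function_entry;
    edge_lift_entry; edge_lift_natural_entry; edge_left_lift_entry;
    edge_right_lift_entry;
    code_entry; code_glue_entry; to_code_entry; preimage_entry;
    preimage_path_entry; find_preimage_entry;
    decode_entry; decode_code_entry; decode_encode_entry ].

Definition constants : list cst :=
  [ cCind 0 0; cReq 0; cRinv 0; cLeq 0; cLinv 0; cGl 0; cNil 0; cC 0;
    cPOindGlue 0 1; cPOind 0 1; cPOind 0 0; cPOglue 0; cPOinr 0; cPOinl 0; cPO 0;
    cUnivalence 0; cSumInd 0 0; cInr 0; cInl 0; cSum 0;
    cSigInd 1 1; cSigInd 0 0; cPair 1; cPair 0; cSig 1; cSig 0;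
    cJ 1 1; cJ 1 0; cJ 0 1; cJ 0 0; cRefl 1; cRefl 0; cId 1; cId 0 ].

Lemma main_term_checks :
  proves 1000 constants development (close main_term) (close main_type) = true.
Proof.
  (* 1000 bounds the depth of the recursion, not its length. *)
  vm_compute. reflexivity.
Qed.

Theorem theorem20 (n : nat) :
  derivable
    (Π L : univ n, Π M : univ n, Π N : univ n, Π f : (L ⇒ M), Π g : (L ⇒ N),
     Π x : hsum n M N, Π y : hsum n M N,
       let s := Span L M N f g in
       equiv n (hid n (po n s) (po_in n s x) (po_in n s y)) (C n s x y))%hott.
Proof.
  destruct (proves_sound _ _ _ _ _ main_term_checks) as [t Ht].
  exists (raise n t). exact (raise_typing n [] t _ Ht).
Qed.
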